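(* Consider a kernel based on a discrete lattice $\mathbf{L}\subset\mathbb{R}^D$ with elementary cell $\mathbf{C}$, say $$K^{\mathrm{per}}(x,y):=\frac1{|\mathbf{C}|}\big\langle e^{2i\pi\langle x-y,\cdot\rangle},\rho\big\rangle_{\ell^2(\mathbf{L}^* )},$$ determined from a generating function $\rho$ defined on the dual lattice $\mathbf{L}^*$. Then, for any set $Y=(y^1,\dots,y^N)$ of points in $\mathbf{C}$ and any $\mathbf{L}$-periodic function $\varphi\in\mathcal{H}_{K^{\mathrm{per}}}^{s,p}(\mathbf{C})$ (for some $s>0$ and $p\in[1,+\infty)$ with $1/p+1/p'=1$), one has $$\Big|\int_{\mathbf{C}}\varphi(x)\,dx-\frac1N\sum_{1\le n\le N}\varphi(y^n)\Big|\le E_{K^{\mathrm{per}}}^{s,p}(Y)\,\|\varphi\|_{\mathcal{H}_{K^{\mathrm{per}}}^{s,p}(\mathbf{C})}$$ with $$\Big(E_{K^{\mathrm{per}}}^{s,p}(Y)\Big)^p:=\sum_{\alpha^*\in\mathbf{L}^*}\rho(\alpha^* )^s\,\Big|\int_{\mathbf{C}}e^{2i\pi\langle x,\alpha^*\rangle}\,dx-\frac1N\sum_{n=1}^Ne^{2i\pi\langle y^n,\alpha^*\rangle}\Big|^p.$$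
   Context: Given vectors $l_1,\dots,l_D$ forming a basis of $\mathbb{R}^D$, $\mathbf{L}=\{\sum_d\alpha_dl_d:\alpha\in\mathbb{Z}^D\}$ is the lattice they generate, $\mathbf{C}$ is its fundamental cell spanned by the $l_d$, with volume $|\mathbf{C}|$, and $\mathbf{L}^*=\{\alpha^*\in\mathbb{R}^D:\langle\alpha,\alpha^*\rangle\in\mathbb{Z}\text{ for all }\alpha\in\mathbf{L}\}$ is the dual lattice. The inner product on $\ell^2(\mathbf{L}^* )$ is $\langle f,g\rangle_{\ell^2(\mathbf{L}^* )}:=\frac1{|\mathbf{C}|}\sum_{\alpha^*\in\mathbf{L}^*}f(\alpha^* )g(\alpha^* )$. The generating function $\rho:\mathbf{L}^*\to(0,+\infty)$ is positive and even with $\rho^{1/2}\in\ell^2(\mathbf{L}^* )$, and, for the Banach space below, $\rho^s\in\ell^p(\mathbf{L}^* )$. For an $\mathbf{L}$-periodic function, $\widehat\varphi(\alpha^* )=\int_{\mathbf{C}}\varphi(x)e^{-2i\pi\langle x,\alpha^*\rangle}\,dx$. The space $\mathcal{H}_{K^{\mathrm{per}}}^{s,p}(\mathbf{C})$ consists of the continuous $\mathbf{L}$-periodic functions $\varphi$ on $\mathbb{R}^D$ with $\widehat\varphi\,\rho^{-s/p}\in\ell^{p'}(\mathbf{L}^* )$, with norm $\|\widehat\varphi\,\rho^{-s/p}\|_{\ell^{p'}(\mathbf{L}^* )}$, where $\ell^{p'}(\mathbf{L}^* )$ carries the same weight $1/|\mathbf{C}|$ as $\ell^2(\mathbf{L}^*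 )$ (supremum norm if $p=1$).
   Formalization: The displayed inequality fails when |C|<1 (e.g. φ=1 with ρ tiny off 0); it is proved as displayed for |C|≥1, and for every lattice with the extra factor |C|^{-1/p} on the right-hand side. *)

(* Defs.v *)
From HB Require Import structures.
From mathcomp Require Import all_boot all_order all_algebra.
From mathcomp Require Import complex.
From mathcomp Require Import all_classical all_reals all_analysis.
Set Implicit Arguments.
Unset Strict Implicit.
Unset Printing Implicit Defensive.
Import Order.TTheory GRing.Theory Num.Theory.
Import numFieldNormedType.Exports.

Local Open Scope classical_set_scope.
Local Open Scope ring_scope.

(* The Borel sigma-algebra of R^n: the one generated by the coordinates. *)
Definition measure_row_display : measure_display -> measure_display.
Proof. exact. Qed.

Section measurable_row.
Context {d} {T : sigmaRingType d} (n : nat).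

Let coors : 'I_n -> 'rV[T]_n -> T := fun i x => x ord0 i.

Let row_set0 : g_sigma_preimage coors set0.
Proof. exact: sigma_algebra0. Qed.

Let row_setC A : g_sigma_preimage coors A -> g_sigma_preimage coors (~` A).
Proof. exact: sigma_algebraC. Qed.

Let row_bigcup (F : _^nat) : (forall i, g_sigma_preimage coors (F i)) ->
  g_sigma_preimage coors (\bigcup_i (F i)).
Proof. exact: sigma_algebra_bigcup. Qed.

HB.instance Definition _ := @isMeasurable.Build (measure_row_display d)
  'rV[T]_n (g_sigma_preimage coors) row_set0 row_setC row_bigcup.

End measurable_row.

Lemma measurable_coord d (T : sigmaRingType d) n (i : 'I_n) :
  measurable_fun [set: 'rV[T]_n] (fun x => x ord0 i).
Proof.
move=> _ Y mY; rewrite setTI; apply: sub_sigma_algebra => /=.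
rewrite -bigcup_seq/=; exists i => /=; first by rewrite mem_index_enum.
by exists Y => //; rewrite setTI.
Qed.

Lemma measurable_fun_row d1 d2 (T1 : measurableType d1) (T2 : sigmaRingType d2)
    n (f : T1 -> 'rV[T2]_n) :
  (forall i, measurable_fun [set: T1] (fun x => f x ord0 i)) ->
  measurable_fun [set: T1] f.
Proof.
move=> mf.
have H : measurable `<=` [set B : set 'rV[T2]_n | measurable (f @^-1` B)].
  apply: smallest_sub.
    split => /=.
    - by rewrite preimage_set0.
    - by move=> A mA; rewrite setTD preimage_setC; exact: measurableC.
    - by move=> F mF; rewrite preimage_bigcup; exact: bigcupT_measurable.
  move=> B; rewrite -bigcup_seq => -[i _ [C mC <-]] /=.
  by rewrite setTI -[X in measurable X]setTI; exact: mf.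
by move=> _ Y /H mY; rewrite setTI.
Qed.

Section lebesgue_row.
Variable R : realType.

Definition row_cons n (p : measurableTypeR R * 'rV[R]_n) : 'rV[R]_n.+1 :=
  row_mx (const_mx p.1 : 'rV_1) p.2.

Lemma row_cons0 n (p : measurableTypeR R * 'rV[R]_n) :
  row_cons p ord0 ord0 = p.1.
Proof.
have -> : (ord0 : 'I_n.+1) = lshift n (ord0 : 'I_1) by exact/val_inj.
by rewrite /row_cons (@row_mxEl _ _ 1) mxE.
Qed.

Lemma row_consS n (p : measurableTypeR R * 'rV[R]_n) j :
  row_cons p ord0 (lift ord0 j) = p.2 ord0 j.
Proof.
have -> : lift ord0 j = rshift 1 j by exact/val_inj.
by rewrite /row_cons (@row_mxEr _ _ 1).
Qed.

Lemma measurable_row_cons n : measurable_fun setT (@row_cons n).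
Proof.
apply: measurable_fun_row => i; have [j ->|->] := unliftP ord0 i.
- apply: (eq_measurable_fun (fun x : measurableTypeR R * 'rV[R]_n => x.2 ord0 j)).
    by move=> x _; rewrite row_consS.
  apply: (@measurableT_comp _ _ _ _ _ _ (fun v : 'rV[R]_n => v ord0 j)).
    exact: measurable_coord.
  exact: measurable_snd.
- apply: (eq_measurable_fun (fun x : measurableTypeR R * 'rV[R]_n => x.1 : R)).
    by move=> x _; rewrite row_cons0.
  exact: measurable_fst.
Qed.

Section step.
Variables (n : nat) (m : {sigma_finite_measure set 'rV[R]_n -> \bar R}).

Definition lebesgue_step : set 'rV[R]_n.+1 -> \bar R :=
  pushforward (@lebesgue_measure R \x m)%E (@row_cons n).

Let step0 : lebesgue_step set0 = 0%E.
Proof. by rewrite /lebesgue_step /pushforward preimage_set0 measure0. Qed.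

Let step_ge0 A : (0 <= lebesgue_step A)%E.
Proof. by rewrite /lebesgue_step /pushforward measure_ge0. Qed.

Let step_sigma_additive : semi_sigma_additive lebesgue_step.
Proof.
move=> F mF tF mUF; rewrite /lebesgue_step /pushforward preimage_bigcup.
apply: measure_semi_sigma_additive.
- by move=> k; rewrite -[X in measurable X]setTI; exact: measurable_row_cons.
- apply/trivIsetP => /= i j _ _ ij; rewrite -preimage_setI.
  by move/trivIsetP : tF => /(_ _ _ _ _ ij) ->//; rewrite preimage_set0.
- by rewrite -preimage_bigcup -[X in measurable X]setTI;
    exact: measurable_row_cons.
Qed.

HB.instance Definition _ := isMeasure.Build _ _ _
  lebesgue_step step0 step_ge0 step_sigma_additive.

Let step_sigma_finite : sigma_finite setT lebesgue_step.
Proof.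
have [F FT mF] : sigma_finite setT (@lebesgue_measure R \x m)%E.
  have /sigma_finiteP[F [TF ndF Foo]] := sigma_finiteT (@lebesgue_measure R).
  have /sigma_finiteP[G [TG ndG Goo]] := sigma_finiteT m.
  exists (fun k => F k `*` G k).
    rewrite -setXTT TF TG predeqE => -[x y]; split.
      move=> [/= [i _ Fix] [k _ Gky]]; exists (maxn i k) => //; split.
      - by move: x Fix; exact/subsetPset/ndF/leq_maxl.
      - by move: y Gky; exact/subsetPset/ndG/leq_maxr.
    by move=> [i _ []/= ? ?]; split; exists i.
  move=> k; have [? ?] := Foo k; have [? ?] := Goo k.
  split; first exact: measurableX.
  by rewrite product_measure1E// lte_mul_pinfty// ge0_fin_numE.
pose g (x : 'rV[R]_n.+1) : measurableTypeR R * 'rV[R]_n :=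
  (x ord0 ord0, \row_j x ord0 (lift ord0 j)).
have mg : measurable_fun setT g.
  apply: measurable_fun_pair; first exact: measurable_coord.
  apply: measurable_fun_row => j; rewrite (_ : (fun x => _) =
    fun x : 'rV[R]_n.+1 => x ord0 (lift ord0 j)); first exact: measurable_coord.
  by apply/funext => x; rewrite mxE.
have gK p : g (row_cons p) = p.
  rewrite /g row_cons0 [RHS]surjective_pairing; congr pair.
  by apply/rowP => j; rewrite mxE row_consS.
exists (fun k => g @^-1` F k).
  by rewrite -preimage_bigcup -FT preimage_setT.
move=> k; have [mFk Fk] := mF k; split.
  by rewrite -[X in measurable X]setTI; exact: mg.
rewrite /lebesgue_step /pushforward -comp_preimage.
by rewrite (_ : g \o _ = id) //; apply/funext => p; exact: gK.
Qed.

HB.instance Definition _ :=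
  Measure_isSigmaFinite.Build _ _ _ lebesgue_step step_sigma_finite.

End step.

Fixpoint lebesgue_row n : {sigma_finite_measure set 'rV[R]_n -> \bar R} :=
  match n with
  | 0 => \d_(0 : 'rV[R]_0)
  | n'.+1 => lebesgue_step (lebesgue_row n')
  end.

Lemma lebesgue_row_box n (A : 'I_n -> set (measurableTypeR R)) :
  (forall i, measurable (A i)) ->
  lebesgue_row n [set x : 'rV[R]_n | forall i, A i (x ord0 i)] =
  (\prod_(i < n) lebesgue_measure (A i))%E.
Proof.
elim: n A => [|n IH] A mA /=.
  by rewrite big_ord0 diracE mem_set// => -[].
rewrite big_ord_recl -IH//= /lebesgue_step /pushforward.
rewrite -product_measure1E//; last first.
  rewrite (_ : [set x | _] = \bigcap_(i in setT)
    ((fun x : 'rV[R]_n => x ord0 i) @^-1` A (lift ord0 i))); last first.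
    by apply/seteqP; split=> x /= Ax i; [move=> _|]; exact: Ax.
  apply: fin_bigcap_measurable => // i _.
  rewrite -[X in measurable X]setTI.
  exact: (@measurable_coord _ R n i measurableT _ (mA _)).
congr (_ _); apply/seteqP; split => -[x v] /= H.
- split=> [|i]; first by have := H ord0; rewrite row_cons0.
  by have := H (lift ord0 i); rewrite row_consS.
- case: H => Ax Av i; have [j ->|->] := unliftP ord0 i.
    by rewrite row_consS; exact: Av.
  by rewrite row_cons0.
Qed.

End lebesgue_row.

Definition dot (R : realType) D (x y : 'rV[R]_D) : R :=
  \sum_(i < D) x ord0 i * y ord0 i.

Definition lattice (R : realType) D (l : D.-tuple 'rV[R]_D) : set 'rV[R]_D :=
  [set x | exists k : 'I_D -> int, x = \sum_(d < D) tnth l d *~ k d].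

Definition dual_lattice (R : realType) D (l : D.-tuple 'rV[R]_D) :
    set 'rV[R]_D :=
  [set a | forall x, lattice l x -> dot x a \is a Num.int].

(* Half-open, so that the lattice translates of the cell tile R^D. *)
Definition cell (R : realType) D (l : D.-tuple 'rV[R]_D) : set 'rV[R]_D :=
  [set x | exists2 t : 'I_D -> R, forall d, 0 <= t d < 1 &
    x = \sum_(d < D) t d *: tnth l d].

Definition vol (R : realType) D (l : D.-tuple 'rV[R]_D) : R :=
  fine (lebesgue_row R D (cell l)).

Definition periodic (R : realType) D (l : D.-tuple 'rV[R]_D) (T : Type)
    (f : 'rV[R]_D -> T) : Prop :=
  forall x a, lattice l a -> f (x + a) = f x.

Local Open Scope complex_scope.

Definition cis (R : realType) (t : R) : R[i] := cos t +i* sin t.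

Definition cintegral (R : realType) D (A : set 'rV[R]_D)
    (f : 'rV[R]_D -> R[i]) : R[i] :=
  (\int[lebesgue_row R D]_(x in A) complex.Re (f x)) +i*
  (\int[lebesgue_row R D]_(x in A) complex.Im (f x)).

(* Unordered sums; meaningful for absolutely summable families. *)
Definition rsum (R : realType) (T : choiceType) (A : set T) (f : T -> R) : R :=
  fine (\esum_(a in A) (f^\+ a)%:E)%E - fine (\esum_(a in A) (f^\- a)%:E)%E.

Definition csum (R : realType) (T : choiceType) (A : set T) (f : T -> R[i]) :
    R[i] :=
  rsum A (fun a => complex.Re (f a)) +i* rsum A (fun a => complex.Im (f a)).

(* e^{2 i pi <x, a>} *)
Definition character (R : realType) D (x a : 'rV[R]_D) : R[i] :=
  cis (2 * pi * dot x a).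

Definition fourier (R : realType) D (l : D.-tuple 'rV[R]_D)
    (phi : 'rV[R]_D -> R[i]) (a : 'rV[R]_D) : R[i] :=
  cintegral (cell l) (fun x => phi x * cis (- (2 * pi * dot x a))).

Definition inner_l2 (R : realType) D (l : D.-tuple 'rV[R]_D)
    (f g : 'rV[R]_D -> R[i]) : R[i] :=
  (vol l)^-1%:C * csum (dual_lattice l) (fun a => f a * g a).

(* The norm of l^q(L^* ), with weight 1/|C| when q is finite. *)
Definition lq_norm (R : realType) D (l : D.-tuple 'rV[R]_D) (q : \bar R)
    (f : 'rV[R]_D -> R) : \bar R :=
  match q with
  | r%:E => (((vol l)^-1%:E *
              \esum_(a in dual_lattice l) (`|f a| `^ r)%:E) `^ r^-1)%E
  | +oo%E => ereal_sup [set `|f a|%:E | a in dual_lattice l]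
  | -oo%E => 0%E
  end.

Definition generating_function (R : realType) D (l : D.-tuple 'rV[R]_D)
    (rho : 'rV[R]_D -> R) : Prop :=
  [/\ forall a, dual_lattice l a -> 0 < rho a,
      forall a, dual_lattice l a -> rho (- a) = rho a &
      (lq_norm l 2%:E (fun a => (rho a `^ 2^-1)%R) < +oo)%E].

Definition K_per (R : realType) D (l : D.-tuple 'rV[R]_D)
    (rho : 'rV[R]_D -> R) (x y : 'rV[R]_D) : R[i] :=
  (vol l)^-1%:C * inner_l2 l (character (x - y)) (fun a => (rho a)%:C).

Definition H_norm (R : realType) D (l : D.-tuple 'rV[R]_D)
    (rho : 'rV[R]_D -> R) (s p : R) (phi : 'rV[R]_D -> R[i]) : \bar R :=
  lq_norm l (hoelder_conjugate p%:E)
    (fun a => Normc.normc (fourier l phi a) * rho a `^ (- (s / p))).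

Definition H_space (R : realType) D (l : D.-tuple 'rV[R]_D)
    (rho : 'rV[R]_D -> R) (s p : R) : set ('rV[R]_D -> R[i]) :=
  [set phi | [/\ continuous (phi : 'rV[R]_D -> (R[i] : numFieldType)),
                 periodic l phi & (H_norm l rho s p phi < +oo)%E]].

Definition quad_error (R : realType) D (l : D.-tuple 'rV[R]_D) N
    (y : 'I_N -> 'rV[R]_D) (f : 'rV[R]_D -> R[i]) : R[i] :=
  cintegral (cell l) f - N%:R^-1 * \sum_(n < N) f (y n).

(* May be +oo when p > 1: the summability of rho and of rho^(s p) over the
   dual lattice does not entail that of rho^s. *)
Definition E_per (R : realType) D (l : D.-tuple 'rV[R]_D)
    (rho : 'rV[R]_D -> R) (s p : R) N (y : 'I_N -> 'rV[R]_D) : \bar R :=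
  ((\esum_(a in dual_lattice l)
     (rho a `^ s *
      Normc.normc (quad_error l y (fun x => character x a)) `^ p)%:E)
   `^ p^-1)%E.

(* Main.v *)
Require Import Defs.
From HB Require Import structures.
From mathcomp Require Import all_boot all_order all_algebra.
From mathcomp Require Import complex.
From mathcomp Require Import all_classical all_reals all_analysis.
From mathcomp Require Import measurable_realfun ring lra zify.
Set Implicit Arguments.
Unset Strict Implicit.
Unset Printing Implicit Defensive.
Import Order.TTheory GRing.Theory Num.Theory.
Import numFieldNormedType.Exports.
Local Open Scope classical_set_scope.
Local Open Scope ring_scope.

(** The error functional sends phi to the integral of phi over the cell minus the
   mean of phi over the nodes. Formally phi is |C|^-1 times the sum of its
   Fourier coefficients against the characters, so the error of phi is |C|^-1
   times the sum over the dual lattice of fourier phi a times the error of the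
   character a. Hoelder's inequality, after inserting rho^(-s/p) rho^(s/p),
   bounds this by E times the norm of phi; the weight 1/|C| carried by the norm
   turns |C|^-1 into |C|^(-1/p), which is at most 1 when |C| >= 1.

   The Fourier series of a continuous function need not converge, so the
   computation is made on means of it. Let k_n be the product over d of
   cos(pi t_d)^(2n), where t_d are the coordinates in the basis l. It is a
   nonnegative trigonometric polynomial with nonnegative coefficients, the
   largest being the one at frequency 0 ([kernel_expansion], [weight_le]).
   Hence the convolution of phi with k_n, divided by the mass of k_n, is a
   trigonometric polynomial whose coefficients are those of phi multiplied by
   factors in [0, 1], the factor at 0 being 1. Its error therefore obeys the
   Hoelder bound, uniformly in n ([lq_norm_hoelder]). It has the same integral
   as phi ([summation_mean]) and converges to phi at every point
   ([kernel_approximation]), so its error converges to that of phi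
   ([quad_error_le]).

   The convergence is a concentration argument: away from the lattice k_n is at
   most q^n with q < 1, whereas its mass |C| (binomial(2n, n) / 4^n)^D is at
   least |C| (2n + 1)^-D ([kernel_concentration], [mean_weight_ge]). The mass
   comes from the orthogonality of the characters: translation by a suitable
   fraction of a basis vector changes the sign of a nontrivial character and,
   Lebesgue measure being translation invariant, preserves integrals of
   periodic functions over the cell ([cell_integral_torus_shift]).

   The bound is uniform over finite sets of frequencies, so it stays valid
   without summability of the Fourier coefficients. When E is infinite, either
   the norm is nonzero and the bound is trivial, or the norm vanishes, all the
   finite Hoelder sums vanish, and so does the error. *)

(** * Lattice coordinates and dual vectors *)

Section coordinates.
Context (R : realType) (D : nat) (l : D.-tuple 'rV[R]_D).
Hypothesis hl : basis_of fullv l.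

Lemma basis_expand (x : 'rV[R]_D) : x = \sum_(d < D) coord l d x *: tnth l d.
Proof.
rewrite {1}(coord_basis hl (memvf x)).
by apply: eq_bigr => d _; rewrite (tnth_nth 0).
Qed.

Lemma coord_tnth d e : coord l d (tnth l e) = (d == e)%:R.
Proof.
rewrite (tnth_nth 0) coord_free 1?eq_sym//.
exact: basis_free hl.
Qed.

Lemma coord_comb (t : 'I_D -> R) d :
  coord l d (\sum_(e < D) t e *: tnth l e) = t d.
Proof.
rewrite linear_sum (bigD1 d)//= linearZ/= coord_tnth eqxx mulr1 big1 ?addr0//.
by move=> e /negPf ed; rewrite linearZ/= coord_tnth eq_sym ed mulr0.
Qed.

Lemma cellP x : cell l x <-> forall d, 0 <= coord l d x < 1.
Proof.
split=> [[t t01 ->] d|x01]; first by rewrite coord_comb.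
by exists (coord l ^~ x) => //; exact: basis_expand.
Qed.

(** The vector representing the coordinate form [coord l d] for [dot]; these
   vectors generate the dual lattice. *)
Definition dual_vector d : 'rV[R]_D := \row_i coord l d (delta_mx 0 i).

Lemma coordE d x : coord l d x = \sum_(i < D) x ord0 i * dual_vector d ord0 i.
Proof.
rewrite {1}(row_sum_delta x) linear_sum; apply: eq_bigr => i _.
by rewrite linearZ/= mxE.
Qed.

Definition dual_comb (m : 'I_D -> int) : 'rV[R]_D :=
  \sum_(d < D) dual_vector d *~ m d.

Lemma dot_dual_comb x m :
  dot x (dual_comb m) = \sum_(d < D) (m d)%:~R * coord l d x.
Proof.
under [RHS]eq_bigr do rewrite coordE mulr_sumr.
rewrite exchange_big; apply: eq_bigr => i _.
rewrite summxE mulr_sumr; apply: eq_bigr => d _.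
by rewrite -scaler_int mxE mulrCA.
Qed.

Lemma coord_lattice x d : lattice l x -> coord l d x \is a Num.int.
Proof.
move=> [k ->]; under eq_bigr do rewrite -scaler_int.
by rewrite coord_comb rpred_int.
Qed.

Lemma dual_comb_in m : dual_lattice l (dual_comb m).
Proof.
move=> x lx; rewrite dot_dual_comb rpred_sum// => d _.
by rewrite rpredM ?rpred_int// coord_lattice.
Qed.

Lemma dot_tnth_dual_comb d m : dot (tnth l d) (dual_comb m) = (m d)%:~R.
Proof.
rewrite dot_dual_comb (bigD1 d)//= coord_tnth eqxx mulr1 big1 ?addr0//.
by move=> e /negPf ed; rewrite coord_tnth ed mulr0.
Qed.

Lemma dual_comb_inj m m' : dual_comb m = dual_comb m' -> m =1 m'.
Proof.
by move=> mm' d; apply/eqP; rewrite -(eqr_int R) -!dot_tnth_dual_comb mm'.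
Qed.

(** With the next lemma: entries and lattice coordinates control each other, so
   that boxes and parallelepipeds can be compared. *)
Lemma le_coord d (x : 'rV[R]_D) (r : R) : 0 <= r -> (forall i, `|x ord0 i| <= r) ->
  `|coord l d x| <= r * \sum_(e < D) \sum_(i < D) `|dual_vector e ord0 i|.
Proof.
move=> r0 xr; rewrite coordE (le_trans (ler_norm_sum _ _ _))//.
apply: (@le_trans _ _ (\sum_(i < D) r * `|dual_vector d ord0 i|)).
  by apply: ler_sum => i _; rewrite normrM ler_wpM2r.
rewrite -mulr_sumr ler_wpM2l// [leRHS](bigD1 d)//= lerDl sumr_ge0// => e _.
exact: sumr_ge0.
Qed.

Lemma le_entry (x : 'rV[R]_D) (r : R) i : 0 <= r -> (forall d, `|coord l d x| <= r) ->
  `|x ord0 i| <= r * \sum_(d < D) \sum_(j < D) `|tnth l d ord0 j|.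
Proof.
move=> r0 xr; rewrite {1}(basis_expand x) summxE.
rewrite (le_trans (ler_norm_sum _ _ _))// mulr_sumr ler_sum// => d _.
rewrite mxE normrM ler_pM// (bigD1 i)//= lerDl.
exact: sumr_ge0.
Qed.

End coordinates.

(** * Lebesgue measure on row vectors *)

Section measure.
Context (R : realType).

Lemma measurable_preimage d1 d2 (T1 : measurableType d1)
    (T2 : measurableType d2) (f : T1 -> T2) A :
  measurable_fun setT f -> measurable A -> measurable (f @^-1` A).
Proof. by move=> mf mA; rewrite -[X in measurable X]setTI; exact: mf. Qed.

(** The sigma-algebra on rows is generated by the coordinates, so that
   open sets are measurable is part of the claim. Composing [g] with
   the rounding of the entries down to multiples of 1/(k+1) gives a function with
   countably many values, taken on unions of boxes, and by continuity these
   functions converge to [g]. *)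
Lemma continuous_measurable_row n (g : 'rV[R]_n -> R) :
  continuous g -> measurable_fun setT g.
Proof.
move=> cg.
pose fl k (x : 'rV[R]_n) : {ffun 'I_n -> int} :=
  [ffun i => Num.floor (x ord0 i * k.+1%:R)].
pose un k (m : {ffun 'I_n -> int}) : 'rV[R]_n :=
  \row_i ((m i)%:~R / k.+1%:R).
apply: (@measurable_fun_cvg _ _ _ _ (fun k x => g (un k (fl k x)))).
  move=> k _ Y mY; rewrite setTI.
  rewrite (_ : _ @^-1` Y = \bigcup_m ([set _ | Y (g (un k m))] `&`
     \bigcap_(i in [set: 'I_n])
       ((fun x : 'rV[R]_n => Num.floor (x ord0 i * k.+1%:R)) @^-1` [set m i]))).
    apply: countable_bigcupT_measurable => [|m]; first exact: countableP.
    apply: measurableI.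
      have [Ym|nYm] := pselect (Y (g (un k m))).
        by rewrite (_ : mkset _ = setT)//; apply/seteqP; split.
      by rewrite (_ : mkset _ = set0)//; apply/seteqP; split.
    apply: fin_bigcap_measurable => // i _.
    rewrite (_ : _ @^-1` _ = (fun x : 'rV[R]_n => x ord0 i) @^-1`
      `[(m i)%:~R / k.+1%:R, (m i + 1)%:~R / k.+1%:R[).
      apply: measurable_preimage; last exact: measurable_itv.
      exact: (@measurable_coord _ (measurableTypeR R)).
    apply/seteqP; split=> x /=.
    - move=> xm; rewrite in_itv/= ler_pdivrMr// ltr_pdivlMr//.
      by rewrite -xm floor_itv.
    - rewrite in_itv/= ler_pdivrMr// ltr_pdivlMr// => xm.
      exact: floor_def.
  apply/seteqP; split=> x /=.
  - by move=> Yx; exists (fl k x) => //; split => //= i _; rewrite ffunE.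
  - move=> [m _ [Ym xm]]; suff -> : fl k x = m by [].
    by apply/ffunP => i; rewrite ffunE xm.
move=> x _; apply: continuous_cvg; first exact: cg.
apply/cvgrPdist_le => e e0.
near=> k.
rewrite [leLHS]mx_normrE; apply: bigmax_le; first exact: ltW.
move=> [i j] _ /=; rewrite (ord1 i) !mxE ffunE.
have /andP[fl1 fl2] := floor_itv (x ord0 j * k.+1%:R).
rewrite ger0_norm; last by rewrite subr_ge0 ler_pdivrMr.
rewrite intrD in fl2.
apply: (@le_trans _ _ k.+1%:R^-1); last first.
  by apply/ltW; near: k; exact: near_infty_natSinv_lt (PosNum e0).
rewrite -(ler_pM2r (ltr0Sn R k)) mulrBl divfK// mulVf// lerBlDl.
exact: ltW.
Unshelve. all: by end_near.
Qed.

Lemma lebesgue_measure_shift (h : R) (A : set (measurableTypeR R)) :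
  measurable A ->
  lebesgue_measure ((fun x : R => x + h) @^-1` A) = lebesgue_measure A.
Proof.
have mh : measurable_fun [set: measurableTypeR R]
    ((fun x : R => x + h) : _ -> measurableTypeR R).
  exact: measurable_funD.
move=> mA; rewrite [RHS](@lebesgue_measure_unique R
  (pushforward (@lebesgue_measure R)
    ((fun x : R => x + h) : measurableTypeR R -> measurableTypeR R)))//.
move=> _ [[a b]] _ <-; rewrite /pushforward/=.
rewrite [X in _ = lebesgue_measure X](_ : _ = `]a - h, b - h]%classic); last first.
  by apply/seteqP; split=> x /=; rewrite !in_itv/= ltrBlDr lerBrDr.
rewrite !lebesgue_measure_itv/= !lte_fin ltrD2r; case: ifP => // _.
by rewrite -!EFinB; congr _%:E; lra.
Qed.

Lemma measurable_row_shift n (h : 'rV[R]_n) :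
  measurable_fun setT (fun x : 'rV[R]_n => x + h).
Proof.
apply: measurable_fun_row => i.
rewrite (_ : (fun x => _) = fun x : 'rV[R]_n => x ord0 i + h ord0 i).
  apply: (@measurable_funD _ _ _ setT (fun x : 'rV[R]_n => x ord0 i)) => //.
  exact: (@measurable_coord _ (measurableTypeR R)).
by apply/funext => x; rewrite mxE.
Qed.

(** Induction on the dimension: a translation of R x R^n is a product of
   translations, and a product measure is determined by its values on
   rectangles. *)
Lemma lebesgue_row_shift n (h : 'rV[R]_n) (A : set 'rV[R]_n) :
  measurable A ->
  lebesgue_row R n ((fun x => x + h) @^-1` A) = lebesgue_row R n A.
Proof.
elim: n h A => [|n IH] h A mA.
  rewrite (_ : _ @^-1` _ = A)//; apply/seteqP.
  by split=> x; rewrite /= [x + h]thinmx0 [x]thinmx0.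
pose T := (measurableTypeR R * 'rV[R]_n)%type.
pose sh (p : T) : T := (p.1 + h ord0 ord0, p.2 + \row_j h ord0 (lift ord0 j)).
have msh : measurable_fun setT sh.
  apply: measurable_fun_pair.
    exact: measurable_funD.
  exact: (measurableT_comp (measurable_row_shift
    (\row_j h ord0 (lift ord0 j))) measurable_snd).
have shE (p : T) : row_cons (sh p) = row_cons p + h.
  apply/rowP => i; rewrite [RHS]mxE; have [j ->|->] := unliftP ord0 i.
    by rewrite !row_consS !mxE.
  by rewrite !row_cons0.
rewrite /= /lebesgue_step /pushforward.
rewrite [RHS](@product_measure_unique _ _ _ _ _ _ _
  (pushforward (@lebesgue_measure R \x lebesgue_row R n)%E sh))//.
- rewrite /pushforward; congr (_ _).
  by apply/seteqP; split=> p; rewrite /= shE.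
- move=> B C mB mC; rewrite /pushforward.
  transitivity ((lebesgue_measure \x lebesgue_row R n)%E
    (((fun x : R => x + h ord0 ord0) @^-1` B) `*`
    ((fun x => x + \row_j h ord0 (lift ord0 j)) @^-1` C))).
    by [].
  rewrite product_measure1E//.
  + by congr (_ * _)%E; [exact: lebesgue_measure_shift|exact: IH].
  + by apply: measurable_preimage => //; exact: measurable_funD.
  + by apply: measurable_preimage => //; exact: measurable_row_shift.
- by apply: measurable_preimage => //; exact: measurable_row_cons.
Qed.

Lemma measurable_box n (a b : 'I_n -> R) :
  measurable [set x : 'rV[R]_n | forall i, `[a i, b i]%classic (x ord0 i)].
Proof.
rewrite (_ : mkset _ = \bigcap_(i in [set: 'I_n])
    ((fun x : 'rV[R]_n => x ord0 i) @^-1` `[a i, b i])); last first.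
  by apply/seteqP; split=> x /= Ax i; [move=> _|]; exact: Ax.
apply: fin_bigcap_measurable => // i _.
apply: measurable_preimage => //.
exact: (@measurable_coord _ (measurableTypeR R)).
Qed.

Lemma lebesgue_row_itv n (a b : 'I_n -> R) : (forall i, a i < b i) ->
  lebesgue_row R n [set x : 'rV[R]_n | forall i, `[a i, b i]%classic (x ord0 i)]
  = (\prod_(i < n) (b i - a i))%:E.
Proof.
move=> ab; rewrite (lebesgue_row_box (A := fun i => `[a i, b i]%classic))//.
rewrite -prodEFin; apply: eq_bigr => i _.
by rewrite lebesgue_measure_itv/= lte_fin ab.
Qed.

End measure.

(** * The volume of the cell *)

Section cell_measure.
Context (R : realType) (D : nat) (l : D.-tuple 'rV[R]_D).
Hypothesis hl : basis_of fullv l.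

Lemma measurable_lattice_coord d : measurable_fun setT (coord l d).
Proof.
rewrite (_ : coord l d = fun x : 'rV[R]_D =>
  \sum_(i <- index_enum 'I_D) x ord0 i * dual_vector l d ord0 i).
  apply: measurable_sum => i; apply: measurable_funM => //.
  exact: (@measurable_coord _ (measurableTypeR R)).
by apply/funext => x; rewrite coordE.
Qed.

Lemma measurable_cell : measurable (cell l).
Proof.
rewrite (_ : cell l = \bigcap_(d in [set: 'I_D]) (coord l d @^-1` `[0, 1[)).
  apply: fin_bigcap_measurable => // d _.
  by apply: measurable_preimage; [exact: measurable_lattice_coord|].
apply/seteqP; split=> x.
- by move=> /(cellP hl) xC d _ /=; rewrite in_itv/=; exact: xC.
- by move=> xC; apply/(cellP hl) => d; have := xC d I; rewrite /= in_itv.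
Qed.

Lemma cell_bounded : exists2 M : R, 0 < M &
  forall x, cell l x -> forall i, `|x ord0 i| <= M.
Proof.
exists (1 + 1 * \sum_(d < D) \sum_(j < D) `|tnth l d ord0 j|).
  rewrite ltr_pwDl// mul1r sumr_ge0// => d _; exact: sumr_ge0.
move=> x /(cellP hl) xC i; apply: (le_trans (le_entry hl (r := 1) _ _ _)) => //.
  by move=> d; have /andP[? /ltW] := xC d; rewrite ger0_norm.
by rewrite lerDr.
Qed.

Lemma lebesgue_cell_lty : (lebesgue_row R D (cell l) < +oo)%E.
Proof.
have [M M0 CM] := cell_bounded.
pose B := [set x : 'rV[R]_D |
  forall i, `[- M, M]%classic (x ord0 i)].
apply: (@le_lt_trans _ _ (lebesgue_row R D B)).
  apply: le_measure; rewrite ?inE; [exact: measurable_cell|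
    exact: (measurable_box (fun=> - M) (fun=> M))|].
  by move=> x /CM xM i /=; rewrite in_itv/= -ler_norml.
rewrite (lebesgue_row_itv (a := fun=> - M) (b := fun=> M)) ?ltry//.
by move=> _; rewrite gtrN.
Qed.

(** The cell contains a small box around its center, the point whose lattice
   coordinates are all 1/2. *)
Lemma lebesgue_cell_gt0 : (0 < lebesgue_row R D (cell l))%E.
Proof.
pose K := \sum_(e < D) \sum_(i < D) `|dual_vector l e ord0 i|.
have K0 : 0 <= K by apply: sumr_ge0 => d _; exact: sumr_ge0.
pose r := (4 * (K + 1))^-1.
have r0 : 0 < r by rewrite invr_gt0 mulr_gt0// ltr_wpDl.
pose c := \sum_(d < D) 2^-1 *: tnth l d.
pose B := [set x : 'rV[R]_D |
  forall i, `[c ord0 i - r, c ord0 i + r]%classic (x ord0 i)].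
apply: (@lt_le_trans _ _ (lebesgue_row R D B)).
  rewrite (lebesgue_row_itv (a := fun i => c ord0 i - r)
                            (b := fun i => c ord0 i + r)).
    by rewrite lte_fin prodr_gt0// => i _; lra.
  by move=> i; lra.
apply: le_measure; rewrite ?inE; [
  exact: (measurable_box (fun i => c ord0 i - r) (fun i => c ord0 i + r))|
  exact: measurable_cell|].
move=> x xB; apply/(cellP hl) => d.
have : `|coord l d (x - c)| <= r * K.
  apply: le_coord => // [|i]; first exact: ltW.
  have := xB i; rewrite /= in_itv/= !mxE ler_norml => /andP[? ?].
  by apply/andP; split; lra.
have -> : coord l d (x - c) = coord l d x - 2^-1.
  by rewrite linearB/= coord_comb.
have : r * K <= 4^-1.
  by rewrite /r invfM -mulrA ler_piMr// mulrC ler_pdivrMr; lra.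
by rewrite ler_norml => ? /andP[? ?]; apply/andP; split; lra.
Qed.

Lemma vol_gt0 : 0 < vol l.
Proof. by rewrite /vol fine_gt0// lebesgue_cell_gt0 lebesgue_cell_lty. Qed.

End cell_measure.

(** * Integrals of continuous functions over the cell *)

Section cell_integral.
Context (R : realType) (D : nat) (l : D.-tuple 'rV[R]_D).
Hypothesis hl : basis_of fullv l.

Let mu := lebesgue_row R D.

(** The half-open cell is not compact, but it lies in a compact box. *)
Lemma cell_continuous_bounded (g : 'rV[R]_D -> R) : continuous g ->
  exists M : R, forall x, cell l x -> `|g x| <= M.
Proof.
move=> cg; have [M M0 CM] := cell_bounded hl.
pose B := [set x : 'rV[R]_D | forall i, `[- M, M]%classic (x ord0 i)].
have cB : compact (g @` B).
  apply: continuous_compact; first exact: continuous_subspaceT.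
  by apply: (@rV_compact _ _ (fun=> `[- M, M]%classic)) => _;
    exact: segment_compact.
have [N [_ /(_ (N + 1))]] := compact_bounded cB.
rewrite ltrDl ltr01 => /(_ isT) gN.
exists (N + 1) => x /CM xM; apply: gN; exists x => // i /=.
by rewrite in_itv/= -ler_norml.
Qed.

Lemma cell_integrable (g : 'rV[R]_D -> R) : continuous g ->
  mu.-integrable (cell l) (EFin \o g).
Proof.
move=> cg; apply: measurable_bounded_integrable.
- exact: measurable_cell.
- exact: lebesgue_cell_lty.
- by apply: measurable_funTS; exact: continuous_measurable_row.
have [M gM] := cell_continuous_bounded cg.
exists M; split; first exact: num_real.
by move=> N MN x /gM /le_trans; apply; exact: ltW.
Qed.

Lemma continuous_shift (g : 'rV[R]_D -> R) (h : 'rV[R]_D) : continuous g ->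
  continuous (fun x : 'rV[R]_D => g (x + h)).
Proof.
move=> cg x; apply: (continuous_comp (f := fun x : 'rV[R]_D => x + h)); last exact: cg.
exact: (cvgD (F := nbhs x) (f := id) (g := cst h) cvg_id (cvg_cst h)).
Qed.

Lemma continuous_scale (r : R) (g : 'rV[R]_D -> R) : continuous g ->
  continuous (fun x : 'rV[R]_D => r * g x).
Proof.
move=> cg x.
have cr : {for x, continuous (fun=> r : R)} by exact: cst_continuous.
exact: (continuousM cr (cg x)).
Qed.

Lemma integral_row_shift (B : set 'rV[R]_D) (g : 'rV[R]_D -> R) (h : 'rV[R]_D) :
  measurable B -> B `<=` cell l -> continuous g ->
  (\int[mu]_(x in (fun x => x + h) @^-1` B) g (x + h) = \int[mu]_(x in B) g x)%R.
Proof.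
move=> mB BC cg; rewrite /Rintegral; congr fine.
have msh := measurable_row_shift h.
pose sh (x : 'rV[R]_D) := x + h.
transitivity (\int[pushforward mu sh]_(x in B) (g x)%:E)%E.
  rewrite integral_pushforward//.
  - by apply/measurable_EFinP; exact: continuous_measurable_row.
  - have [M gM] := cell_continuous_bounded cg.
    apply: (@measurable_bounded_integrable _ _ _ _ (g \o sh)).
    + exact: measurable_preimage.
    + rewrite [X in (X < _)%E](lebesgue_row_shift h mB).
      apply: le_lt_trans (lebesgue_cell_lty hl).
      by apply: le_measure; rewrite ?inE//; exact: measurable_cell.
    + apply: measurable_funTS; apply: continuous_measurable_row.
      exact: continuous_shift.
    + exists M; split; first exact: num_real.
      by move=> N MN x /BC /gM /le_trans; apply; exact: ltW.
by apply: eq_measure_integral => A mA _; exact: lebesgue_row_shift.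
Qed.

(** The translate of the cell by [t *: tnth l d] overhangs it by a slab, which
   translation by the lattice vector [- tnth l d] puts back: integrals of
   periodic functions live on the torus. *)
Lemma cell_integral_torus_shift (g : 'rV[R]_D -> R) d (t : R) :
  continuous g -> Defs.periodic l g -> 0 < t < 1 ->
  \int[mu]_(x in cell l) g (x + t *: tnth l d) = \int[mu]_(x in cell l) g x.
Proof.
move=> cg pg /andP[t0 t1].
pose H (r : R) := coord l d @^-1` `[r, +oo[.
pose L (r : R) := coord l d @^-1` `]-oo, r[.
have mH r : measurable (H r).
  by apply: measurable_preimage => //; exact: measurable_lattice_coord.
have mL r : measurable (L r).
  by apply: measurable_preimage => //; exact: measurable_lattice_coord.
have mC := measurable_cell hl.
have split_cell f r : continuous f -> \int[mu]_(x in cell l) f x =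
    \int[mu]_(x in cell l `&` L r) f x + \int[mu]_(x in cell l `&` H r) f x.
  move=> cf; rewrite -Rintegral_setU; last 4 first.
  - exact: measurableI.
  - exact: measurableI.
  - apply: (integrableS mC); [|by rewrite -setIUr; exact: subIsetl|].
      by apply: measurableU; exact: measurableI.
    exact: cell_integrable.
  - rewrite disj_set2E; apply/eqP/seteqP; split => // x [[_ +] [_]].
    by rewrite /L /H /= !in_itv/= andbT ltNge => /negP.
  rewrite -setIUr (_ : _ `|` _ = setT) ?setIT//; apply/seteqP; split=> // x _.
  rewrite /L /H /= !in_itv/= andbT.
  by have [?|?] := ltP (coord l d x) r; [left|right].
have shift_coord r e x : coord l e (x + r *: tnth l d) =
    coord l e x + r * (e == d)%:R.
  by rewrite linearD/= linearZ/= coord_tnth.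
(* The part with coordinate below 1 - t stays in the cell when translated; the
   rest is brought back by one period, a translation by t - 1. *)
have low_shift : cell l `&` L (1 - t) =
    (fun x => x + t *: tnth l d) @^-1` (cell l `&` H t).
  rewrite /H /L; apply/seteqP; split=> x /=; rewrite !in_itv/= andbT shift_coord
      eqxx mulr1 => -[/(cellP hl) xC xd].
    have /andP[? ?] := xC d; split; last by lra.
    apply/(cellP hl) => e; rewrite shift_coord; have [->|_] := eqVneq e d.
      by rewrite mulr1; apply/andP; split; lra.
    by rewrite mulr0 addr0.
  split; last by have := xC d; rewrite shift_coord eqxx mulr1 => /andP[]; lra.
  apply/(cellP hl) => e; have := xC e; rewrite shift_coord.
  have [->|_] := eqVneq e d; last by rewrite mulr0 addr0.
  by rewrite mulr1 => /andP[? ?]; apply/andP; split; lra.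
have high_shift : cell l `&` H (1 - t) =
    (fun x => x + (t - 1) *: tnth l d) @^-1` (cell l `&` L t).
  rewrite /H /L; apply/seteqP; split=> x /=; rewrite !in_itv/= andbT shift_coord
      eqxx mulr1 => -[/(cellP hl) xC xd].
    have /andP[? ?] := xC d; split; last by lra.
    apply/(cellP hl) => e; rewrite shift_coord; have [->|_] := eqVneq e d.
      by rewrite mulr1; apply/andP; split; lra.
    by rewrite mulr0 addr0.
  have := xC d; rewrite shift_coord eqxx mulr1 => /andP[? ?].
  split; last by lra.
  apply/(cellP hl) => e; have := xC e; rewrite shift_coord.
  have [->|_] := eqVneq e d; last by rewrite mulr0 addr0.
  by rewrite mulr1 => /andP[? ?]; apply/andP; split; lra.
have ld : lattice l (tnth l d).
  exists (fun e => (e == d)%:R); rewrite (bigD1 d)//= eqxx mulr1z big1 ?addr0//.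
  by move=> e /negPf ->; rewrite mulr0z.
rewrite (split_cell _ (1 - t)); last exact: continuous_shift.
rewrite (split_cell g t)// addrC; congr (_ + _).
- rewrite -[RHS](@integral_row_shift _ _ ((t - 1) *: tnth l d))//;
    last exact: measurableI.
  rewrite high_shift; apply: eq_Rintegral => x _.
  by rewrite -[RHS](pg _ (tnth l d))// scalerBl scale1r addrA subrK.
- rewrite -[RHS](@integral_row_shift _ _ (t *: tnth l d))//;
    last exact: measurableI.
  by rewrite low_shift.
Qed.

Lemma cell_integral_cst (r : R) : \int[mu]_(_ in cell l) r = r * vol l.
Proof. by rewrite Rintegral_cst//; exact: measurable_cell. Qed.

Lemma continuous_dot (a : 'rV[R]_D) : continuous (fun x : 'rV[R]_D => dot x a).
Proof.
apply: (continuous_big (op := +%R)); first exact: add_continuous.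
move=> i _ x; have /= := @coord_continuous R 1 D ord0 i x.
by move=> ci; apply: (cvgM ci); exact: cvg_cst.
Qed.

End cell_integral.

(** * The unit circle *)

Section cis.
Context (R : realType).
Local Open Scope complex_scope.
Implicit Types s t : R.

Lemma cisD s t : cis (s + t) = cis s * cis t.
Proof.
by rewrite /cis sinD cosD; apply/eqP; rewrite eq_complex/= eqxx addrC eqxx.
Qed.

Lemma cis0 : cis 0 = 1 :> R[i].
Proof. by rewrite /cis cos0 sin0. Qed.

Lemma cis_sum (I : finType) (f : I -> R) :
  cis (\sum_i f i) = \prod_i cis (f i).
Proof. exact: (big_morph _ cisD cis0). Qed.

Lemma cisMn t n : cis (t *+ n) = cis t ^+ n.
Proof.
by elim: n => [|n IH]; rewrite ?mulr0n ?cis0// mulrS cisD IH exprS.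
Qed.

Lemma cisN t : cis t * cis (- t) = 1.
Proof. by rewrite -cisD subrr cis0. Qed.

Lemma cis_2pi_int t : t \is a Num.int -> cis (2 * pi * t) = 1.
Proof.
move=> /intrP[k ->].
have cis_nat (n : nat) : cis (2 * pi * n%:R : R) = 1.
  rewrite mulr_natr cisMn (_ : cis _ = 1) ?expr1n//.
  by rewrite /cis mulr_natl cos2pi sin2pi.
case: k => n; first exact: cis_nat.
by rewrite NegzE mulrNz mulrN -[LHS]mul1r -(cis_nat n.+1) cisN.
Qed.

End cis.

(** * Complex integrals over the cell *)

Section complex_cell_integral.
Context (R : realType) (D : nat) (l : D.-tuple 'rV[R]_D).
Hypothesis hl : basis_of fullv l.
Local Open Scope complex_scope.

(** [cintegral] is defined on real and imaginary parts, so it is on them that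
   continuity, hence integrability, is used. *)
Definition parts_continuous (f : 'rV[R]_D -> R[i]) :=
  continuous (fun x => complex.Re (f x)) /\ continuous (fun x => complex.Im (f x)).

Lemma parts_continuous_cst c : parts_continuous (fun=> c).
Proof. by split; exact: cst_continuous. Qed.

Lemma parts_continuousD f g : parts_continuous f -> parts_continuous g ->
  parts_continuous (fun x => f x + g x).
Proof.
move=> [rf jf] [rg jg]; split=> x.
- rewrite (_ : (fun x => _) = fun x => complex.Re (f x) + complex.Re (g x)).
    exact: (continuousD (rf x) (rg x)).
  by apply/funext => z; case: (f z) (g z) => a b [].
- rewrite (_ : (fun x => _) = fun x => complex.Im (f x) + complex.Im (g x)).
    exact: (continuousD (jf x) (jg x)).
  by apply/funext => z; case: (f z) (g z) => a b [].
Qed.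

Lemma parts_continuousM f g : parts_continuous f -> parts_continuous g ->
  parts_continuous (fun x => f x * g x).
Proof.
move=> [rf jf] [rg jg]; split=> x.
- rewrite (_ : (fun x => _) = fun x =>
    complex.Re (f x) * complex.Re (g x) - complex.Im (f x) * complex.Im (g x)).
    exact: (continuousB (continuousM (rf x) (rg x)) (continuousM (jf x) (jg x))).
  by apply/funext => z; case: (f z) (g z) => a b [].
- rewrite (_ : (fun x => _) = fun x =>
    complex.Re (f x) * complex.Im (g x) + complex.Im (f x) * complex.Re (g x)).
    exact: (continuousD (continuousM (rf x) (jg x)) (continuousM (jf x) (rg x))).
  by apply/funext => z; case: (f z) (g z) => a b [].
Qed.

Lemma parts_continuous_sum (I : Type) (r : seq I) (f : I -> 'rV[R]_D -> R[i]) :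
  (forall i, parts_continuous (f i)) ->
  parts_continuous (fun x => \sum_(i <- r) f i x).
Proof.
move=> cf; elim: r => [|i r IH].
  by under eq_fun do rewrite big_nil; exact: parts_continuous_cst.
by under eq_fun do rewrite big_cons; exact: parts_continuousD.
Qed.

Lemma parts_continuous_cis (t : 'rV[R]_D -> R) : continuous t ->
  parts_continuous (fun x => cis (t x)).
Proof.
move=> ct; split=> x.
- by apply: (continuous_comp (g := cos)); [exact: ct|exact: continuous_cos].
- by apply: (continuous_comp (g := sin)); [exact: ct|exact: continuous_sin].
Qed.

Lemma parts_continuous_character a :
  parts_continuous (fun x : 'rV[R]_D => character x a).
Proof.
apply: parts_continuous_cis; apply: continuous_scale; exact: continuous_dot.
Qed.

Lemma continuous_parts (f : 'rV[R]_D -> R[i]) :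
  continuous (f : 'rV[R]_D -> (R[i] : numFieldType)) -> parts_continuous f.
Proof.
move=> cf.
have close x (e : R) : 0 < e ->
    \forall y \near x, Normc.normc (f x - f y) < e.
  move=> e0.
  have e0' : 0 < e%:C :> R[i] by rewrite ltcR.
  have := cf x; move/cvgrPdist_lt => /(_ _ e0').
  apply: filterS => y; by rewrite ltcR.
split=> x; apply/(cvgrPdist_lt (FF := nbhs_filter x)) => e /(close x);
  apply: filterS => y.
- apply: le_lt_trans; case: (f x) (f y) => a b [c d] /=.
  by rewrite -sqrtr_sqr ler_wsqrtr// lerDl sqr_ge0.
- apply: le_lt_trans; case: (f x) (f y) => a b [c d] /=.
  by rewrite -sqrtr_sqr ler_wsqrtr// lerDr sqr_ge0.
Qed.

Lemma cintegralD f g : parts_continuous f -> parts_continuous g ->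
  cintegral (cell l) (fun x => f x + g x) =
  cintegral (cell l) f + cintegral (cell l) g.
Proof.
move=> [rf jf] [rg jg].
have mC := measurable_cell hl.
rewrite /cintegral; congr (_ +i* _); rewrite -RintegralD//;
  try exact: cell_integrable.
- by apply: eq_Rintegral => z _; case: (f z) (g z) => a b [].
- by apply: eq_Rintegral => z _; case: (f z) (g z) => a b [].
Qed.

Lemma cintegralZ c f : parts_continuous f ->
  cintegral (cell l) (fun x => c * f x) = c * cintegral (cell l) f.
Proof.
move=> [rf jf].
have mC := measurable_cell hl.
have iZ (g : 'rV[R]_D -> R) r : continuous g ->
    (lebesgue_row R D).-integrable (cell l) (EFin \o (fun x => r * g x)).
  move=> cg; apply: cell_integrable => //; exact: continuous_scale.
case: c => a b; rewrite /cintegral.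
congr (_ +i* _); rewrite -!RintegralZl//; try exact: cell_integrable.
- rewrite -RintegralB//; try exact: iZ.
  by apply: eq_Rintegral => z _; case: (f z).
- rewrite -RintegralD//; try exact: iZ.
  by apply: eq_Rintegral => z _; case: (f z).
Qed.

Lemma cintegral0 : cintegral (cell l) (fun=> 0) = 0.
Proof. by rewrite /cintegral /= !cell_integral_cst// mul0r. Qed.

Lemma cintegral_sum (I : Type) (r : seq I) (f : I -> 'rV[R]_D -> R[i]) :
  (forall i, parts_continuous (f i)) ->
  cintegral (cell l) (fun x => \sum_(i <- r) f i x) =
  \sum_(i <- r) cintegral (cell l) (f i).
Proof.
move=> cf; elim: r => [|i r IH].
  by rewrite big_nil -[RHS]cintegral0; congr (cintegral _ _); apply/funext => x;
    rewrite big_nil.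
rewrite big_cons -IH -cintegralD//; last exact: parts_continuous_sum.
by congr (cintegral _ _); apply/funext => x; rewrite big_cons.
Qed.

End complex_cell_integral.

(** * Orthogonality of the characters *)

Section orthogonality.
Context (R : realType) (D : nat) (l : D.-tuple 'rV[R]_D).
Hypothesis hl : basis_of fullv l.
Local Open Scope complex_scope.

Lemma dotDl (x y a : 'rV[R]_D) : dot (x + y) a = dot x a + dot y a.
Proof.
by rewrite -big_split; apply: eq_bigr => i _; rewrite mxE mulrDl.
Qed.

Lemma dotZl (t : R) (x a : 'rV[R]_D) : dot (t *: x) a = t * dot x a.
Proof. by rewrite mulr_sumr; apply: eq_bigr => i _; rewrite mxE mulrA. Qed.

Lemma dot0r (x : 'rV[R]_D) : dot x 0 = 0.
Proof. by rewrite /dot big1// => i _; rewrite mxE mulr0. Qed.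

Lemma characterD (x y a : 'rV[R]_D) :
  character (x + y) a = character x a * character y a.
Proof. by rewrite /character dotDl mulrDr cisD. Qed.

Lemma character_periodic a : dual_lattice l a ->
  Defs.periodic l (fun x => character x a).
Proof.
move=> la x y ly; rewrite characterD [character y a]cis_2pi_int ?mulr1//.
exact: la.
Qed.

Lemma character0 (x : 'rV[R]_D) : character x 0 = 1.
Proof. by rewrite /character dot0r mulr0 cis0. Qed.

Lemma cell_cintegral_cst c : cintegral (cell l) (fun=> c) = c * (vol l)%:C.
Proof.
case: c => a b; rewrite /cintegral !cell_integral_cst//.
by apply/eqP; rewrite eq_complex/= !mulr0 subr0 add0r !eqxx.
Qed.

(** Translation by [tnth l d] divided by [2 |m d|] multiplies the character by
   exp(+-i pi) = -1, and preserves its integral. *)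
Lemma character_integral0 m d : m d != 0 ->
  cintegral (cell l) (fun x => character x (dual_comb l m)) = 0.
Proof.
move=> md0; set a := dual_comb l m; set mu := lebesgue_row R D.
have [rc ic] := @parts_continuous_character R D a.
have pa := character_periodic (dual_comb_in hl m).
pose t : R := (2 * `|m d|%:~R)^-1.
have md1 : 1 <= `|m d|%:~R :> R by rewrite ler1z -gtz0_ge1 normr_gt0.
have t01 : 0 < t < 1.
  have m2 : 1 < 2 * `|m d|%:~R :> R by lra.
  by rewrite invr_gt0 invf_lt1 (lt_trans ltr01 m2).
(* The sign of m d only decides between the angles pi and - pi. *)
have half_turn x : character (x + t *: tnth l d) a = - character x a.
  rewrite characterD; suff -> : character (t *: tnth l d) a = - 1.
    by rewrite mulrN1.
  rewrite /character dotZl dot_tnth_dual_comb//.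
  have [mdp|mdn] := leP 0 (m d).
    have -> : 2 * pi * (t * (m d)%:~R) = pi.
      by rewrite /t ger0_norm//; field; rewrite intr_eq0.
    by rewrite /cis cospi sinpi; apply/eqP; rewrite eq_complex/= oppr0 !eqxx.
  have -> : 2 * pi * (t * (m d)%:~R) = - pi.
    by rewrite /t ltr0_norm// mulrNz; field; rewrite intr_eq0.
  by rewrite /cis cosN sinN cospi sinpi; apply/eqP; rewrite eq_complex/= !eqxx.
have vanish (g : 'rV[R]_D -> R) : continuous g -> Defs.periodic l g ->
    (forall x, g (x + t *: tnth l d) = - g x) ->
    \int[mu]_(x in cell l) g x = 0.
  move=> cg pg gN; have := cell_integral_torus_shift hl d cg pg t01.
  rewrite (@eq_Rintegral _ _ _ _ _ (fun x => -1 * g x)); last first.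
    by move=> x _; rewrite gN mulN1r.
  rewrite RintegralZl//; [|exact: measurable_cell|exact: cell_integrable].
  by rewrite -/mu mulN1r; lra.
rewrite /cintegral !vanish//.
- by move=> x y ly; rewrite pa.
- by move=> x; rewrite half_turn; case: (character x a).
- by move=> x y ly; rewrite pa.
- by move=> x; rewrite half_turn; case: (character x a).
Qed.

End orthogonality.

(** * Powers of the cosine as trigonometric polynomials *)

Section cosine_power.
Context (R : realType).
Local Open Scope complex_scope.

(** The binomial coefficients of an even row increase up to the middle, and the
   row is symmetric. *)
Lemma leq_central_bin n j : ('C(n.*2, j) <= 'C(n.*2, n))%N.
Proof.
have incr i : (i <= n -> 'C(n.*2, i) <= 'C(n.*2, n))%N.
  move=> ein; rewrite -(subKn ein); move: (n - i)%N (leq_subr i n).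
  elim=> [|k IH] kn; first by rewrite subn0.
  apply: leq_trans (IH (ltnW kn)).
  have := mul_bin_left n.*2 (n - k.+1)%N.
  rewrite subnSK// => H.
  rewrite -(@leq_pmul2l (n - k)%N) ?subn_gt0// H leq_mul2r; apply/orP; right.
  lia.
have [/incr//|nj] := leqP j n.
have [j2|j2] := leqP j n.*2; last by rewrite bin_small.
rewrite -bin_sub//; apply: incr; lia.
Qed.

(** Newton's formula for (exp(i pi t) + exp(-i pi t))^(2n). The frequencies come
   out as integers since the exponent 2n is even. *)
Lemma cos_power_expansion (t : R) n :
  (cos (pi * t) ^+ n.*2)%:C =
  \sum_(j < n.*2.+1) ('C(n.*2, j)%:R / 4 ^+ n)%:C *
    cis (2 * pi * ((n%:Z - j%:Z)%:~R * t)).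
Proof.
(* Euler's formula for the cosine *)
have euler : (cos (pi * t))%:C = 2^-1%:C * (cis (pi * t) + cis (- (pi * t))).
  apply/eqP; rewrite eq_complex/= cosN sinN !mul0r subr0 addr0 subrr mulr0 eqxx.
  by rewrite andbT; apply/eqP; field.
rewrite rmorphXn/= euler exprMn exprDn mulr_sumr; apply: eq_bigr => j _.
rewrite -!cisMn -cisD -[in X in _ * X]mulr_natl mulrA.
congr (_ * _).
  rewrite mulrC -[X in X * _](rmorph_nat (real_complex R)) -rmorphXn -rmorphM.
  suff -> : 2^-1 ^+ n.*2 = (4 ^+ n)^-1 :> R by [].
  by rewrite exprVn -mul2n exprM -natrX.
have jn : (j <= n.*2)%N by rewrite -ltnS.
congr cis; rewrite mulNrn mulrnBr//.
have -> : pi * t *+ n.*2 = pi * t * (2 * n%:R).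
  by rewrite -natrM mulr_natr mul2n.
have -> : pi * t *+ j = pi * t * j%:R by rewrite mulr_natr.
by rewrite rmorphB/=; ring.
Qed.

End cosine_power.

(** * The de la Vallee-Poussin kernel *)

Section kernel.
Context (R : realType) (D : nat) (l : D.-tuple 'rV[R]_D).
Hypothesis hl : basis_of fullv l.
Local Open Scope complex_scope.

(** The kernel of de la Vallee-Poussin. Raising cosines to the even power 2n makes
   it nonnegative and periodic for the lattice. *)
Definition vp_kernel n (z : 'rV[R]_D) : R :=
  \prod_(d < D) cos (pi * coord l d z) ^+ n.*2.

Definition frequency n (f : {ffun 'I_D -> 'I_n.*2.+1}) : 'rV[R]_D :=
  dual_comb l (fun d => n%:Z - (f d)%:Z).

(** The coefficient of the kernel at [frequency f]. *)
Definition weight n (f : {ffun 'I_D -> 'I_n.*2.+1}) : R :=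
  \prod_(d < D) ('C(n.*2, f d)%:R / 4 ^+ n).

(** The coefficient of the kernel at frequency 0, that is its mean over the cell. *)
Definition mean_weight n : R := ('C(n.*2, n)%:R / 4 ^+ n) ^+ D.

Lemma kernel_expansion n z :
  (vp_kernel n z)%:C = \sum_f (weight f)%:C * character z (@frequency n f).
Proof.
rewrite /vp_kernel rmorph_prod/=; under eq_bigr do rewrite cos_power_expansion.
rewrite bigA_distr_bigA/=; apply: eq_bigr => f _.
rewrite big_split/= /weight rmorph_prod; congr (_ * _).
rewrite -cis_sum /character /frequency dot_dual_comb -mulr_sumr//.
Qed.

Lemma frequency_inj n : injective (@frequency n).
Proof.
move=> f g /(dual_comb_inj hl) fg; apply/ffunP => d; apply/val_inj.
by have /addrI/oppr_inj [] := fg d.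
Qed.

Lemma weight_ge0 n f : 0 <= @weight n f.
Proof. by apply: prodr_ge0 => d _; rewrite divr_ge0// exprn_ge0. Qed.

Lemma weight_le n f : @weight n f <= mean_weight n.
Proof.
rewrite /weight /mean_weight -[D in leRHS]card_ord -prodr_const.
apply: ler_prod => d _; rewrite divr_ge0 ?exprn_ge0//=.
by rewrite ler_pM2r ?invr_gt0 ?exprn_gt0// ler_nat leq_central_bin.
Qed.

(** 4^n is the sum of the 2n+1 binomial coefficients of row 2n, each at most the
   central one. *)
Lemma mean_weight_ge n : (n.*2.+1%:R ^+ D)^-1 <= mean_weight n.
Proof.
rewrite /mean_weight -exprVn lerXn2r ?nnegrE ?invr_ge0 ?divr_ge0 ?exprn_ge0//.
rewrite ler_pdivlMr ?exprn_gt0// ler_pdivrMl// -natrX -natrM ler_nat.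
rewrite (_ : 4 ^ n = (1 + 1) ^ n.*2)%N; last by rewrite -mul2n expnM.
rewrite expnDn; apply: (@leq_trans (\sum_(i < n.*2.+1) 'C(n.*2, n))).
  by apply: leq_sum => i _; rewrite !exp1n !muln1 leq_central_bin.
by rewrite sum_nat_const card_ord.
Qed.

Lemma mean_weight_gt0 n : 0 < mean_weight n.
Proof. by apply: lt_le_trans (mean_weight_ge n); rewrite invr_gt0 exprn_gt0. Qed.

(** The frequency of the index f is n - f, so frequency 0 sits at the constant
   index n. *)
Definition zero_index n : {ffun 'I_D -> 'I_n.*2.+1} := [ffun=> inord n].

Lemma zero_indexE n d : zero_index n d = n :> nat.
Proof. by rewrite ffunE inordK// ltnS -addnn leq_addr. Qed.

Lemma weight_zero_index n : weight (zero_index n) = mean_weight n.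
Proof.
rewrite /weight /mean_weight -[in RHS](card_ord D) -prodr_const.
by apply: eq_bigr => d _; rewrite zero_indexE.
Qed.

Lemma frequency_zero_index n : frequency (zero_index n) = 0.
Proof. by rewrite /frequency /dual_comb big1// => d _; rewrite zero_indexE subrr. Qed.

Lemma neq_zero_index n (f : {ffun 'I_D -> 'I_n.*2.+1}) : f != zero_index n ->
  exists d, (f d)%:Z != n%:Z.
Proof.
move=> fc; apply/existsP; apply: contraNT fc; rewrite negb_exists.
move=> /forallP fn; apply/eqP/ffunP => d; apply/val_inj => /=.
by rewrite zero_indexE; have := fn d; rewrite negbK => /eqP[].
Qed.

Lemma frequency_integral n f :
  cintegral (cell l) (fun x => character x (@frequency n f)) =
  (f == zero_index n)%:R * (vol l)%:C.
Proof.
have [->|fc] := eqVneq f (zero_index n).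
  rewrite frequency_zero_index mul1r -[RHS]mul1r -cell_cintegral_cst//.
  by congr cintegral; apply/funext => x; rewrite character0.
have [d fd] := neq_zero_index fc.
rewrite mul0r; apply: (character_integral0 hl (d := d)).
by rewrite subr_eq0 eq_sym.
Qed.

Lemma continuous_lattice_coord d : continuous (fun x : 'rV[R]_D => coord l d x).
Proof.
rewrite (_ : (fun x => _) = fun x => dot x (dual_vector l d)).
  exact: continuous_dot.
by apply/funext => x; rewrite coordE.
Qed.

Lemma kernelB n x y : (vp_kernel n (x - y))%:C =
  \sum_f (weight f)%:C * character x (@frequency n f) *
    cis (- (2 * pi * dot y (@frequency n f))).
Proof.
rewrite kernel_expansion; apply: eq_bigr => f _.
by rewrite characterD mulrA /character -scaleN1r dotZl mulN1r mulrN.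
Qed.

Lemma fourier_integrand_continuous (phi : 'rV[R]_D -> R[i]) a :
  parts_continuous phi ->
  parts_continuous (fun y => phi y * cis (- (2 * pi * dot y a))).
Proof.
move=> cphi; apply: parts_continuousM => //; apply: parts_continuous_cis.
rewrite (_ : (fun x => _) = fun y : 'rV[R]_D => - (2 * pi) * dot y a).
  by apply: continuous_scale; exact: continuous_dot.
by apply/funext => y; rewrite mulNr.
Qed.

(** The kernel is a finite sum of characters, and a character of x - y separates
   the two variables, so the convolution is a trigonometric polynomial in x. *)
Lemma kernel_convolution n (phi : 'rV[R]_D -> R[i]) x : parts_continuous phi ->
  cintegral (cell l) (fun y => phi y * (vp_kernel n (x - y))%:C) =
  \sum_f (weight f)%:C * character x (@frequency n f) *
    fourier l phi (@frequency n f).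
Proof.
move=> cphi.
rewrite (_ : (fun y => _) = fun y => \sum_f (weight f)%:C *
    character x (@frequency n f) *
    (phi y * cis (- (2 * pi * dot y (@frequency n f))))); last first.
  apply/funext => y; rewrite kernelB mulr_sumr; apply: eq_bigr => f _.
  by rewrite mulrCA.
rewrite cintegral_sum//; last first.
  move=> f; apply: parts_continuousM; first exact: parts_continuous_cst.
  exact: fourier_integrand_continuous.
apply: eq_bigr => f _; rewrite cintegralZ//.
exact: fourier_integrand_continuous.
Qed.

Lemma continuous_kernel n x : continuous (fun y : 'rV[R]_D => vp_kernel n (x - y)).
Proof.
rewrite /vp_kernel; 
apply: (@continuous_big R _ *%R 1 xpredT (@mul_continuous R)).
move=> d _ y.
have cx : {for y, continuous (fun y : 'rV[R]_D => pi * coord l d (x - y))}.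
  rewrite (_ : (fun y => _) =
    fun y : 'rV[R]_D => pi * coord l d x + - pi * coord l d y).
    apply: continuousD; first exact: cst_continuous.
    by apply: continuous_scale; exact: continuous_lattice_coord.
  by apply/funext => z; rewrite linearB/= mulrBr mulNr.
have ct (t : R) : {for t, continuous (fun t : R => cos t ^+ n.*2)}.
  apply: (@continuous_comp _ _ _ (@cos R) (fun u : R => u ^+ n.*2)).
    exact: continuous_cos.
  exact: exprn_continuous.
exact: (continuous_comp cx (ct _)).
Qed.

Lemma kernel_ge0 n z : 0 <= vp_kernel n z.
Proof. by apply: prodr_ge0 => d _; rewrite -mul2n exprM exprn_ge0// sqr_ge0. Qed.

Lemma fourier_one n f :
  fourier l (fun=> 1) (@frequency n f) = (f == zero_index n)%:R * (vol l)%:C.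
Proof.
have [->|fc] := eqVneq f (zero_index n).
  rewrite frequency_zero_index /fourier mul1r -[RHS]mul1r -cell_cintegral_cst//.
  congr cintegral; apply/funext => x.
  by rewrite dot0r mulr0 oppr0 cis0 mulr1.
have [d fd] := neq_zero_index fc.
rewrite mul0r /fourier -[RHS](@character_integral0 _ _ _ hl
  (fun d => (f d)%:Z - n%:Z) d) ?subr_eq0//.
congr cintegral; apply/funext => x.
rewrite mul1r /character /frequency !dot_dual_comb// -mulrN -sumrN.
congr (cis (_ * _)); apply: eq_bigr => e _.
by rewrite -mulNr -rmorphN opprB.
Qed.

(** The convolution of the kernel with the constant 1, where orthogonality leaves
   only frequency 0; in particular the mass does not depend on [x]. *)
Lemma kernel_integral n x :
  \int[lebesgue_row R D]_(y in cell l) vp_kernel n (x - y) = mean_weight n * vol l.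
Proof.
have c1 : parts_continuous (fun _ : 'rV[R]_D => 1 : R[i]).
  exact: parts_continuous_cst.
have := kernel_convolution n x c1.
rewrite (bigD1 (zero_index n))//= big1 ?addr0; last first.
  by move=> f /negPf fc; rewrite fourier_one fc mul0r mulr0.
rewrite fourier_one eqxx mul1r weight_zero_index frequency_zero_index character0 mulr1.
rewrite -rmorphM /= => /(congr1 (@complex.Re R))/= <-.
by apply: eq_Rintegral => y _; rewrite mul1r mul0r subr0.
Qed.

End kernel.

(** * Decay of powers of the cosine *)

Section concentration.
Context (R : realType).

(** With r = - ln q, the inequality x^(D+1) / (D+1)! <= exp x at x = n r shows that
   q^n n^D is O(1/n). *)
Lemma geometric_polynomial_small D (A q e : R) :
  0 <= A -> 0 < q -> q < 1 -> 0 < e ->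
  \forall n \near \oo, A * q ^+ n * n.*2.+1%:R ^+ D <= e.
Proof.
move=> A0 q0 q1 e0.
pose r : R := - ln q.
have r0 : 0 < r by rewrite oppr_gt0 ln_lt0// q0.
pose B : R := A * (3 ^+ D * D.+1`!%:R / r ^+ D.+1).
have B0 : 0 <= B by rewrite mulr_ge0// divr_ge0 ?mulr_ge0 ?exprn_ge0// ltW.
near=> n.
have n0 : 0 < n%:R :> R by rewrite ltr0n; near: n; exact: nbhs_infty_gt.
apply: (@le_trans _ _ (B / n%:R)); last first.
  rewrite ler_pdivrMr// mulrC -ler_pdivrMr//.
  by near: n; exact: nbhs_infty_ger.
have qn : q ^+ n <= D.+1`!%:R / (n%:R * r) ^+ D.+1.
  have -> : q ^+ n = (expR (n%:R * r))^-1.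
    by rewrite mulrN expRN invrK mulrC expRM_natr lnK.
  rewrite -[leRHS]invf_div lef_pV2 ?posrE ?expR_gt0//; last first.
    by rewrite divr_gt0 ?exprn_gt0 ?mulr_gt0// ltr0n fact_gt0.
  apply: le_trans (expR_ge1Dxn D _); first by rewrite lerDr.
  by rewrite mulr_ge0// ltW.
have n3 : n.*2.+1%:R ^+ D <= 3 ^+ D * n%:R ^+ D :> R.
  rewrite -exprMn lerXn2r ?nnegrE ?mulr_ge0// -natrM ler_nat.
  by move: n0; rewrite ltr0n; lia.
have qnn3 := ler_pM (exprn_ge0 n (ltW q0)) (exprn_ge0 D (ler0n R _)) qn n3.
rewrite -mulrA; apply: (le_trans (ler_wpM2l A0 qnn3)).
rewrite /B -[leRHS]mulrA ler_wpM2l// le_eqVlt; apply/orP; left; apply/eqP.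
by rewrite exprMn !exprS; field; rewrite ?expf_neq0 ?gt_eqF.
Unshelve. all: by end_near.
Qed.

Definition nearest (t : R) : int := Num.floor (t + 2^-1).

Lemma dist_nearest t : `|t - (nearest t)%:~R| <= 2^-1.
Proof.
have /andP[] := floor_itv (t + 2^-1); rewrite -/(nearest t) intrD => ? ?.
by rewrite ler_norml; apply/andP; split; lra.
Qed.

(** The square of cos(pi t) only depends on the distance of t to the nearest
   integer, and decreases with it. *)
Lemma cos_sq_far (t delta : R) : 0 < delta ->
  delta < `|t - (nearest t)%:~R| -> cos (pi * t) ^+ 2 <= cos (pi * delta) ^+ 2.
Proof.
move=> d0 dt; set u := `|_| in dt.
have u2 : u <= 2^-1 by exact: dist_nearest.
have p0 := pi_gt0 R.
have -> : cos (pi * t) ^+ 2 = cos (pi * u) ^+ 2.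
  (* The half-angle formula turns the period 2 of cos(pi t) into the period 1. *)
have dbl (v : R) : cos (pi * v) ^+ 2 = (cos (2 * pi * v) + 1) / 2.
    by rewrite -mulrA [2 * _]mulr_natl cos_mulr2n subrK -[_ *+ 2]mulr_natr mulfK.
  rewrite !dbl; congr ((_ + 1) / 2).
  rewrite -[in LHS](subrK (nearest t)%:~R t) mulrDr.
  have := congr1 (@complex.Re R) (cisD (2 * pi * (t - (nearest t)%:~R))
    (2 * pi * (nearest t)%:~R)).
  rewrite [cis (2 * pi * (nearest t)%:~R)]cis_2pi_int ?rpred_int// mulr1 /= => ->.
  by rewrite -[LHS]cos_norm -[RHS]cos_norm !normrM normr_id.
have cu : 0 <= cos (pi * u).
  apply: cos_ge0_pihalf; apply/andP; split.
    by have := mulr_gt0 p0 (lt_trans d0 dt); lra.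
  by rewrite ler_pM2l.
have mem (v : R) : 0 <= v <= 2^-1 -> pi * v \in `[0, pi].
  move=> /andP[v0 v2]; rewrite in_itv/= mulr_ge0 ?(ltW p0)//=.
  by rewrite -[leRHS]mulr1 ler_pM2l//; lra.
have cud : cos (pi * u) <= cos (pi * delta).
  apply: ltW; rewrite ltr_cos ?ltr_pM2l//; apply: mem; apply/andP; split; lra.
by rewrite lerXn2r ?nnegrE// (le_trans cu).
Qed.

End concentration.

(** * Convolution with the kernel as an approximation *)

Section approximation.
Context (R : realType) (D : nat) (l : D.-tuple 'rV[R]_D).
Hypothesis hl : basis_of fullv l.
Local Open Scope complex_scope.

Lemma kernel_le_factor n z d q : cos (pi * coord l d z) ^+ 2 <= q ->
  vp_kernel l n z <= q ^+ n.
Proof.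
move=> cq; rewrite /vp_kernel (bigD1 d)//= -[leRHS]mulr1; apply: ler_pM.
- by rewrite -mul2n exprM exprn_ge0// sqr_ge0.
- by apply: prodr_ge0 => e _; rewrite -mul2n exprM exprn_ge0// sqr_ge0.
- rewrite -mul2n exprM lerXn2r ?nnegrE ?sqr_ge0//.
  exact: le_trans (sqr_ge0 _) cq.
- apply: prodr_ile1 => e _; rewrite -mul2n exprM exprn_ge0 ?sqr_ge0//=.
  by rewrite exprn_ile1 ?sqr_ge0// -real_normK ?num_real// exprn_ile1// cos_max.
Qed.

(** If all the coordinates of x - y are within [del] of integers, then y is close to
   a lattice translate of x and periodicity gives the first alternative.
   Otherwise one factor of the kernel is at most q^n with
   q = cos(pi del)^2. *)
Lemma kernel_concentration (g : 'rV[R]_D -> R) x e :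
  continuous g -> Defs.periodic l g -> 0 < e ->
  exists q, 0 < q < 1 /\
    forall n y, `|g y - g x| <= e \/ vp_kernel l n (x - y) <= q ^+ n.
Proof.
move=> cg pg e0.
have := cg x; move/(cvgrPdist_le (FF := nbhs_filter x)) => /(_ e e0).
move=> /nbhs_ballP[delta /= delta0 gx].
pose K := \sum_(d < D) \sum_(j < D) `|tnth l d ord0 j|.
have K0 : 0 <= K by apply: sumr_ge0 => d _; exact: sumr_ge0.
(* The first bound keeps the displacement below delta, the second keeps pi del
   inside the interval where the cosine is positive and decreasing. *)
pose del := Num.min (delta / (2 * (K + 1))) 4^-1.
have del0 : 0 < del.
  by rewrite lt_min divr_gt0 ?mulr_gt0 ?ltr_wpDl//= invr_gt0.
have del4 : del <= 4^-1 by rewrite ge_min lexx orbT.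
have delK : del * K < delta.
  apply: (@le_lt_trans _ _ (delta / (2 * (K + 1)) * K)).
    by rewrite ler_wpM2r// ge_min lexx.
  by rewrite mulrAC ltr_pdivrMr ?mulr_gt0 ?ltr_wpDl// ltr_pM2l//; lra.
have p0 := pi_gt0 R.
have c0 : 0 < cos (pi * del).
  apply: cos_gt0_pihalf; apply/andP; split.
    by have := mulr_gt0 p0 del0; lra.
  by rewrite ltr_pM2l//; lra.
have c1 : cos (pi * del) < 1.
  have pd : pi * del <= pi by rewrite -[leRHS]mulr1 ler_pM2l//; lra.
  rewrite -cos0 ltr_cos ?mulr_gt0// in_itv/= ?lexx ?(ltW p0)//.
  by rewrite ltW ?mulr_gt0.
exists (cos (pi * del) ^+ 2); split.
  by rewrite exprn_gt0//= exprn_ilt1// ltW.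
move=> n y.
have [/existsP[d far]|near_all] := boolP [exists d,
    del < `|coord l d (x - y) - (nearest (coord l d (x - y)))%:~R|].
  by right; apply: (@kernel_le_factor _ _ d); exact: cos_sq_far.
left; pose m d := nearest (coord l d (x - y)).
pose r := \sum_(d < D) (coord l d (x - y) - (m d)%:~R) *: tnth l d.
have <- : g (x - r) = g y.
  rewrite -[RHS](pg _ (\sum_(d < D) tnth l d *~ m d)); last by exists m.
  congr g; rewrite /r; under eq_bigr do rewrite scalerBl scaler_int.
  by rewrite sumrB -basis_expand// !opprB addrCA [x + _]addrC subrK addrC.
rewrite distrC; apply: gx; split=> // i j; rewrite (ord1 i) !mxE /ball/=.
rewrite opprB addrCA subrr addr0.
apply: le_lt_trans delK; apply: (le_entry hl) => [|d]; first exact: ltW.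
rewrite coord_comb// leNgt; apply/negP => far.
by move: near_all; rewrite negb_exists => /forallP/(_ d); rewrite far.
Qed.

(** The part of the integral near the lattice is at most e/2 times the mass. The
   part away from it is at most a constant times q^n, which is small against the
   mass because the latter decays only polynomially. *)
Lemma kernel_approximation (g : 'rV[R]_D -> R) x e :
  continuous g -> Defs.periodic l g -> 0 < e ->
  \forall n \near \oo,
    `|\int[lebesgue_row R D]_(y in cell l) (g y * vp_kernel l n (x - y)) -
      mean_weight R D n * vol l * g x| <= e * (mean_weight R D n * vol l).
Proof.
move=> cg pg e0.
have e20 : 0 < e / 2 by rewrite divr_gt0.
have [q [/andP[q0 q1] gq]] := kernel_concentration x cg pg e20.
have [M gM] := cell_continuous_bounded hl cg.
pose A := `|M| + `|g x|.
have A0 : 0 <= A by rewrite addr_ge0.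
have := geometric_polynomial_small D A0 q0 q1 e20.
apply: filterS => n small.
have mC := measurable_cell hl.
have ck := @continuous_kernel _ _ l n x.
have cc (r : R) : continuous (fun _ : 'rV[R]_D => r : R).
  exact: cst_continuous.
have cgx : continuous (fun y : 'rV[R]_D => g y - g x).
  by move=> y; exact: (continuousB (cg y) (cc _ y)).
have cgk : continuous (fun y : 'rV[R]_D => (g y - g x) * vp_kernel l n (x - y)).
  by move=> y; exact: (continuousM (cgx y) (ck y)).
have cek : continuous (fun y : 'rV[R]_D => e / 2 * vp_kernel l n (x - y)).
  exact: continuous_scale.
have cbd : continuous
    (fun y : 'rV[R]_D => e / 2 * vp_kernel l n (x - y) + A * q ^+ n).
  by move=> y; exact: (continuousD (cek y) (cc _ y)).
have cxk : continuous (fun y : 'rV[R]_D => g x * vp_kernel l n (x - y)).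
  exact: continuous_scale.
have ckg : continuous (fun y : 'rV[R]_D => g y * vp_kernel l n (x - y)).
  by move=> y; exact: (continuousM (cg y) (ck y)).
have -> : mean_weight R D n * vol l * g x =
    \int[lebesgue_row R D]_(y in cell l) (g x * vp_kernel l n (x - y)).
  by rewrite RintegralZl ?kernel_integral 1?mulrC//; exact: cell_integrable.
rewrite -RintegralB//; try exact: cell_integrable.
apply: (le_trans (le_normr_Rintegral mC _)).
  rewrite (_ : (_ \o _) = EFin \o (fun y => (g y - g x) * vp_kernel l n (x - y))).
    exact: cell_integrable.
  by apply/funext => y /=; rewrite mulrBl.
apply: (@le_trans _ _ (\int[lebesgue_row R D]_(y in cell l)
    (e / 2 * vp_kernel l n (x - y) + A * q ^+ n))).
  apply: le_Rintegral => //.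
  - rewrite (_ : (_ \o _) = EFin \o
      (Num.norm \o (fun y => (g y - g x) * vp_kernel l n (x - y)))).
      by apply: integrable_norm; exact: cell_integrable.
    by apply/funext => y /=; rewrite mulrBl.
  - exact: cell_integrable.
  - move=> y yC; rewrite -mulrBl normrM [X in _ * X]ger0_norm ?kernel_ge0//.
    have [gxy|kq] := gq n y.
      rewrite (@le_trans _ _ (e / 2 * vp_kernel l n (x - y)))//.
        by rewrite ler_wpM2r// kernel_ge0.
      by rewrite lerDl mulr_ge0// exprn_ge0// ltW.
    rewrite (@le_trans _ _ (A * q ^+ n))//.
      rewrite ler_pM ?kernel_ge0// (le_trans (ler_normB _ _))// lerD//.
      exact: le_trans (gM _ yC) (ler_norm _).
    by rewrite lerDr mulr_ge0 ?kernel_ge0// ltW.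
rewrite RintegralD//; last 2 first.
- by apply: cell_integrable => //; exact: cek.
- by apply: cell_integrable => //; exact: cc.
rewrite RintegralZl//; last by exact: cell_integrable.
rewrite kernel_integral// cell_integral_cst//.
rewrite mulrA -mulrDl [leRHS]mulrA ler_pM2r ?vol_gt0//.
rewrite [in leRHS](splitr e) [leRHS]mulrDl lerD2l.
apply: le_trans; last exact: (ler_wpM2l (ltW e20) (mean_weight_ge R D n)).
by rewrite ler_pdivlMr// exprn_gt0.
Qed.

End approximation.

(** * Finite sums and weighted norms over the dual lattice *)

Section hoelder.
Context (R : realType).

(** Young's inequality for the entries normalized to have unit norms. *)
Lemma finite_hoelder (I : finType) (u w : I -> R) (r p : R) :
  0 < r -> 0 < p -> r^-1 + p^-1 = 1 ->
  (forall i, 0 <= u i) -> (forall i, 0 <= w i) ->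
  \sum_i u i * w i <=
    (\sum_i u i `^ r) `^ r^-1 * (\sum_i w i `^ p) `^ p^-1.
Proof.
move=> r0 p0 rp u0 w0.
have vanish (v : I -> R) (q : R) : \sum_i v i `^ q = 0 -> forall i, v i = 0.
  move=> v0 i; apply: (@powR_eq0_eq0 _ _ q).
  by apply: (psumr_eq0P _ v0) => // j _; exact: powR_ge0.
set A := \sum_i u i `^ r; set B := \sum_i w i `^ p.
have A0 : 0 <= A by apply: sumr_ge0 => i _; exact: powR_ge0.
have B0 : 0 <= B by apply: sumr_ge0 => i _; exact: powR_ge0.
(* The normalization needs both norms nonzero; otherwise every product is 0. *)
have [Az|An] := eqVneq A 0.
  rewrite big1 ?mulr_ge0 ?powR_ge0// => i _.
  by rewrite (vanish _ _ Az) mul0r.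
have [Bz|Bn] := eqVneq B 0.
  rewrite big1 ?mulr_ge0 ?powR_ge0// => i _.
  by rewrite (vanish _ _ Bz) mulr0.
have Agt : 0 < A by rewrite lt_neqAle eq_sym An.
have Bgt : 0 < B by rewrite lt_neqAle eq_sym Bn.
rewrite -[leRHS]mulr1 -ler_pdivrMl ?mulr_gt0 ?powR_gt0// mulr_sumr.
have normalize (S q x : R) : 0 < S -> 0 < q -> 0 <= x ->
    ((S `^ q^-1)^-1 * x) `^ q = x `^ q / S.
  move=> S0 q0 x0; rewrite powRM ?invr_ge0 ?powR_ge0// mulrC -powRN -powRrM.
  by rewrite mulNr mulVf ?gt_eqF// powR_inv1 ?ltW.
apply: (@le_trans _ _ (\sum_i (u i `^ r / A / r + w i `^ p / B / p))).
  apply: ler_sum => i _; rewrite invfM mulrACA.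
  rewrite -(normalize A r)// -(normalize B p)//; apply: conjugate_powR => //.
  - by rewrite mulr_ge0// invr_ge0 powR_ge0.
  - by rewrite mulr_ge0// invr_ge0 powR_ge0.
by rewrite big_split/= -!mulr_suml -/A -/B !divff// !mul1r rp.
Qed.

Lemma finite_sum_le_esum (T : choiceType) (A : set T) (I : finType) (a : I -> T)
    (f : T -> R) : injective a -> (forall i, A (a i)) ->
  ((\sum_i f (a i))%:E <= \esum_(t in A) (f t)%:E)%E.
Proof.
move=> ainj Aa; apply: esum_ge; exists (a @` [set: I]).
  split; first exact/finite_image/finite_finset.
  by move=> _ [i _ <-].
rewrite fsbig_image; last by move=> i j _ _; exact: ainj.
rewrite (_ : [set: I] = [set` index_enum I]); last first.
  by apply/seteqP; split=> // i _ /=; rewrite mem_index_enum.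
by rewrite -fsbig_seq ?index_enum_uniq// sumEFin.
Qed.

(** The norm carries the weight 1/|C|, hence V^-1 = V^(-1/p) V^(-1/p') lets the
   second factor be absorbed in it. For p = 1 the dual norm is a supremum, and
   the two sides have the same factor V^-1. *)
Lemma lq_norm_hoelder D (l : D.-tuple 'rV[R]_D) (f : 'rV[R]_D -> R) (p : R)
    (I : finType) (a : I -> 'rV[R]_D) (w : I -> R) :
  0 < vol l -> 1 <= p -> injective a -> (forall i, dual_lattice l (a i)) ->
  (forall i, 0 <= w i) -> (lq_norm l (hoelder_conjugate p%:E) f < +oo)%E ->
  (vol l)^-1 * \sum_i `|f (a i)| * w i <= vol l `^ (- p^-1) *
    (fine (lq_norm l (hoelder_conjugate p%:E) f) *
     (\sum_i w i `^ p) `^ p^-1).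
Proof.
move=> V0 p1 ainj la w0; set V := vol l in V0 *.
have p0 : 0 < p by exact: lt_le_trans p1.
have [->|pn1] := eqVneq p 1.
  rewrite hoelder_conjugate1 /= invr1 powR_inv1 ?(ltW V0)// => Hoo.
  rewrite ler_pM2l ?invr_gt0// powRr1 ?sumr_ge0//; last first.
    by move=> i _; exact: powR_ge0.
  rewrite mulr_sumr; apply: ler_sum => i _; rewrite powRr1// ler_wpM2r//.
  have fH : (`|f (a i)|%:E <= ereal_sup [set `|f t|%:E | t in dual_lattice l])%E.
    by apply: ereal_sup_ubound; exists (a i).
  by rewrite -lee_fin fineK// ge0_fin_numE// (le_trans _ fH)// lee_fin.
have pgt1 : 1 < p by rewrite lt_neqAle eq_sym pn1.
pose r := p / (p - 1).
have r0 : 0 < r by rewrite divr_gt0// subr_gt0.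
have rp : r^-1 + p^-1 = 1.
  by rewrite /r; field; rewrite gt_eqF//= subr_eq0 gt_eqF.
have -> : hoelder_conjugate p%:E = r%:E.
  rewrite /hoelder_conjugate/= eqe gt_eqF// -EFinB inver subr_eq0 gt_eqF//.
rewrite /= => Hoo; set H := (_ `^ _)%E in Hoo *.
have H0 : (0 <= H)%E by exact: poweR_ge0.
have uH : (V^-1 * \sum_i `|f (a i)| `^ r) `^ r^-1 <= fine H.
  rewrite -lee_fin fineK ?ge0_fin_numE// -poweR_EFin EFinM.
  apply: gt0_ler_poweR; rewrite ?invr_ge0 ?(ltW r0)// ?in_itv/= ?leey ?andbT.
  - rewrite mule_ge0 ?lee_fin ?invr_ge0 ?(ltW V0)//.
    by rewrite sumr_ge0// => i _; exact: powR_ge0.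
  - rewrite mule_ge0 ?lee_fin ?invr_ge0 ?(ltW V0)// esum_ge0//.
  - rewrite lee_wpmul2l ?lee_fin ?invr_ge0 ?(ltW V0)//.
    exact: (finite_sum_le_esum (fun t => `|f t| `^ r) ainj la).
have S0 : 0 <= \sum_i `|f (a i)| `^ r.
  by apply: sumr_ge0 => i _; exact: powR_ge0.
apply: (@le_trans _ _ (V^-1 * ((\sum_i `|f (a i)| `^ r) `^ r^-1 *
    (\sum_i w i `^ p) `^ p^-1))).
  by rewrite ler_wpM2l ?invr_ge0 ?(ltW V0)// finite_hoelder.
rewrite !mulrA ler_wpM2r ?powR_ge0//.
rewrite powRM ?invr_ge0 ?(ltW V0)// in uH.
have -> : V^-1 = V `^ (- p^-1) * V^-1 `^ r^-1.
  rewrite -[in X in _ * X](powR_inv1 (ltW V0)) -powRrM mulN1r -powRD; last first.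
    by rewrite (gt_eqF V0) implybT.
  by rewrite -opprD addrC rp powR_inv1// ltW.
by rewrite -mulrA ler_wpM2l ?powR_ge0.
Qed.

End hoelder.

(** * The complex modulus *)

Section complex_modulus.
Context (R : realType).
Local Open Scope complex_scope.
Notation normc := (@Normc.normc R).

Lemma normc_ge0 (z : R[i]) : 0 <= normc z.
Proof. by case: z => a b; exact: sqrtr_ge0. Qed.

Lemma normc_real (r : R) : normc r%:C = `|r|.
Proof. by rewrite /= expr0n addr0 sqrtr_sqr. Qed.

Lemma normc_le_parts (z : R[i]) :
  normc z <= `|complex.Re z| + `|complex.Im z|.
Proof.
case: z => a b /=.
rewrite -[leRHS](@ger0_norm R) ?addr_ge0// -sqrtr_sqr ler_wsqrtr//.
rewrite sqrrD !real_normK ?num_real// addrAC lerDl.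
by rewrite mulrn_wge0// mulr_ge0.
Qed.

Lemma normc_sum (I : Type) (r : seq I) (F : I -> R[i]) :
  normc (\sum_(i <- r) F i) <= \sum_(i <- r) normc (F i).
Proof.
elim: r => [|i r IH]; first by rewrite !big_nil Normc.normc0.
by rewrite !big_cons (le_trans (le_normcD _ _))// lerD2l.
Qed.

End complex_modulus.

(** * Quadrature error of a continuous periodic function *)

Section quadrature.
Context (R : realType) (D : nat) (l : D.-tuple 'rV[R]_D).
Hypothesis hl : basis_of fullv l.
Context (phi : 'rV[R]_D -> R[i]).
Hypothesis cphi : parts_continuous phi.
Hypothesis pphi : Defs.periodic l phi.
Context (N : nat) (y : 'I_N -> 'rV[R]_D).
Hypothesis N0 : (0 < N)%N.
Local Open Scope complex_scope.
Notation normc := (@Normc.normc R).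

(** The Fourier coefficient of [phi], up to 1/|C|, damped by the multiplier
   [weight f / mean_weight n] of [0, 1]. *)
Definition summation_coef n (f : {ffun 'I_D -> 'I_n.*2.+1}) : R[i] :=
  ((mean_weight R D n * vol l)^-1 * weight R f)%:C * fourier l phi (frequency l f).

Definition summation n x : R[i] :=
  \sum_f summation_coef f * character x (@frequency R D l n f).

Lemma summation_convolution n x : summation n x =
  ((mean_weight R D n * vol l)^-1)%:C *
    cintegral (cell l) (fun z => phi z * (vp_kernel l n (x - z))%:C).
Proof.
rewrite kernel_convolution// mulr_sumr; apply: eq_bigr => f _.
by rewrite /summation_coef rmorphM/= -!mulrA [character x _ * _]mulrC.
Qed.

Lemma summation_cvg x e : 0 < e ->
  \forall n \near \oo, normc (summation n x - phi x) <= e.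
Proof.
move=> e0; have e20 : 0 < e / 2 by rewrite divr_gt0.
have [rphi iphi] := cphi.
have pr : Defs.periodic l (fun x => complex.Re (phi x)).
  by move=> z a la; rewrite pphi.
have pim : Defs.periodic l (fun x => complex.Im (phi x)).
  by move=> z a la; rewrite pphi.
have := kernel_approximation hl x iphi pim e20.
have := kernel_approximation hl x rphi pr e20.
apply: filterS2 => n closer closei.
apply: (le_trans (normc_le_parts _)); rewrite (splitr e).
rewrite summation_convolution.
set c := mean_weight R D n * vol l.
have c0 : 0 < c by rewrite mulr_gt0 ?mean_weight_gt0 ?vol_gt0.
have part (I0 g : R) : `|I0 - c * g| <= e / 2 * c -> `|c^-1 * I0 - g| <= e / 2.
  move=> h; have -> : c^-1 * I0 - g = c^-1 * (I0 - c * g) by rewrite mulrBr mulKf ?gt_eqF.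
  by rewrite normrM gtr0_norm ?invr_gt0// ler_pdivrMl// [leRHS]mulrC.
apply: lerD.
- rewrite [complex.Re _](_ : _ = c^-1 * (\int[lebesgue_row R D]_(z in cell l)
    (complex.Re (phi z) * vp_kernel l n (x - z))) - complex.Re (phi x)).
    exact: part closer.
  rewrite (raddfB (@complex.Re R)) /cintegral/= mul0r subr0; congr (_ * _ - _).
  apply: eq_Rintegral => z _; case: (phi z) => a b /=.
  by rewrite mulr0 subr0.
- rewrite [complex.Im _](_ : _ = c^-1 * (\int[lebesgue_row R D]_(z in cell l)
    (complex.Im (phi z) * vp_kernel l n (x - z))) - complex.Im (phi x)).
    exact: part closei.
  rewrite (raddfB (@complex.Im R)) /cintegral/= mul0r addr0; congr (_ * _ - _).
  apply: eq_Rintegral => z _; case: (phi z) => a b /=.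
  by rewrite mulr0 add0r.
Qed.

Lemma summation_cintegral n :
  cintegral (cell l) (summation n) =
  \sum_f summation_coef f *
    cintegral (cell l) (fun x => character x (@frequency R D l n f)).
Proof.
rewrite cintegral_sum//; last first.
  move=> f; apply: parts_continuousM; first exact: parts_continuous_cst.
  exact: parts_continuous_character.
apply: eq_bigr => f _; rewrite cintegralZ//.
exact: parts_continuous_character.
Qed.

(** The multiplier at frequency 0 is 1 and the other frequencies have mean 0, so the
   means integrate exactly like [phi]; only the values at the nodes require a
   limit. *)
Lemma summation_mean n :
  cintegral (cell l) (summation n) = cintegral (cell l) phi.
Proof.
rewrite summation_cintegral// (bigD1 (zero_index D n))//= big1 ?addr0; last first.
  by move=> f /negPf fc; rewrite frequency_integral// fc mul0r mulr0.
rewrite frequency_integral// eqxx mul1r /summation_coef weight_zero_index.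
rewrite frequency_zero_index mulrAC -rmorphM/=.
rewrite (_ : _^-1 * _ * vol l = 1 :> R); last first.
  by field; rewrite !gt_eqF ?vol_gt0 ?mean_weight_gt0.
rewrite mul1r; congr cintegral; apply/funext => x.
by rewrite dot0r mulr0 oppr0 cis0 mulr1.
Qed.

Lemma summation_quad_error n : quad_error l y (summation n) =
  \sum_f summation_coef f *
    quad_error l y (fun x => character x (@frequency R D l n f)).
Proof.
rewrite /quad_error summation_cintegral// /summation exchange_big/= mulr_sumr.
rewrite -sumrB; apply: eq_bigr => f _.
by rewrite mulrBr; congr (_ - _); rewrite [RHS]mulrCA -mulr_sumr.
Qed.

(** The multipliers only decrease the terms of the finite sum, so [B] bounds the
   error of all the means, and the means converge to [phi] at each of the
   finitely many nodes. *)
Lemma quad_error_le (B : R) :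
  (forall n, \sum_f normc (fourier l phi (frequency l f)) *
     normc (quad_error l y (fun x => character x (@frequency R D l n f))) <= B) ->
  normc (quad_error l y phi) <= (vol l)^-1 * B.
Proof.
move=> bound; apply/ler_addgt0Pr => e e0.
have [n close] : exists n, forall k, normc (summation n (y k) - phi (y k)) <= e.
  have : \forall n \near \oo, forall k, normc (summation n (y k) - phi (y k)) <= e.
    by apply: filter_forall => k; exact: summation_cvg.
  by move=> [n _ /(_ n (leqnn n))]; exists n.
have -> : quad_error l y phi = quad_error l y (summation n) +
    N%:R^-1 * \sum_k (summation n (y k) - phi (y k)).
  by rewrite /quad_error summation_mean sumrB mulrBr addrA subrK.
apply: (le_trans (le_normcD _ _)); apply: lerD.
  rewrite summation_quad_error (le_trans (normc_sum _ _))//.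
  apply: (@le_trans _ _ (\sum_f (vol l)^-1 *
      (normc (fourier l phi (frequency l f)) *
       normc (quad_error l y (fun x => character x (@frequency R D l n f)))))).
    apply: ler_sum => f _; rewrite Normc.normcM /summation_coef Normc.normcM.
    rewrite [leRHS]mulrA ler_wpM2r ?normc_ge0// ler_wpM2r ?normc_ge0//.
    rewrite normc_real ger0_norm; last first.
      by rewrite mulr_ge0 ?weight_ge0// invr_ge0 mulr_ge0 ?ltW ?mean_weight_gt0 ?vol_gt0.
    rewrite invfM mulrAC -[leRHS]mul1r ler_wpM2r ?invr_ge0 ?(ltW (vol_gt0 hl))//.
    by rewrite mulrC ler_pdivrMr ?mean_weight_gt0// mul1r weight_le.
  by rewrite -mulr_sumr ler_wpM2l ?invr_ge0 ?(ltW (vol_gt0 hl)).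
rewrite Normc.normcM Normc.normcV.
have -> : normc N%:R = N%:R.
  by rewrite -(rmorph_nat (real_complex R)) normc_real ger0_norm.
rewrite ler_pdivrMl ?ltr0n// (le_trans (normc_sum _ _))//.
apply: (@le_trans _ _ (\sum_(k < N) e)); first exact: ler_sum.
by rewrite sumr_const card_ord mulr_natl.
Qed.

End quadrature.

(** * The error bound *)

Theorem proposition5p4 (R : realType) (D : nat) (l : D.-tuple 'rV[R]_D)
    (hl : basis_of fullv l)
    (rho : 'rV[R]_D -> R) (hrho : generating_function l rho)
    (K : 'rV[R]_D -> 'rV[R]_D -> R[i]) (hK : forall x y, K x y = K_per l rho x y)
    (s p : R) (hs : 0 < s) (hp : 1 <= p)
    (hrhos : (lq_norm l p%:E (fun a => (rho a `^ s)%R) < +oo)%E)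
    (N : nat) (hN : (0 < N)%N) (y : 'I_N -> 'rV[R]_D)
    (hy : forall n, cell l (y n))
    (phi : 'rV[R]_D -> R[i]) (hphi : H_space l rho s p phi) :
  (((Normc.normc (quad_error l y phi))%:E <=
      (vol l `^ (- p^-1))%:E * (E_per l rho s p y * H_norm l rho s p phi))%E) /\
  (1 <= vol l ->
   ((Normc.normc (quad_error l y phi))%:E <=
      E_per l rho s p y * H_norm l rho s p phi)%E).
Proof.
have V0 := vol_gt0 hl.
have p0 : 0 < p by exact: lt_le_trans hp.
have [rho0 _ _] := hrho; have [cphi pphi Hoo] := hphi.
set E := E_per l rho s p y; set H := H_norm l rho s p phi in Hoo *.
have E0 : (0 <= E)%E by exact: poweR_ge0.
pose u a := Normc.normc (fourier l phi a) * rho a `^ (- (s / p)).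
pose err a := Normc.normc (quad_error l y (fun x => character x a)).
have u_ge0 a : 0 <= u a by rewrite mulr_ge0 ?normc_ge0 ?powR_ge0.
have H0 : (0 <= H)%E.
  rewrite /H /H_norm; case: (hoelder_conjugate _) => [r||]//=.
    exact: poweR_ge0.
  apply: (@le_trans _ _ `|u 0|%:E); first by rewrite lee_fin.
  apply: ereal_sup_ubound; exists 0 => // x _.
  by rewrite dot0r.
suff main : ((Normc.normc (quad_error l y phi))%:E <=
    (vol l `^ (- p^-1))%:E * (E * H))%E.
  split=> // V1; apply: (le_trans main); rewrite -[leRHS]mul1e.
  rewrite lee_wpmul2r ?mule_ge0// lee_fin -[leRHS](powRr0 (vol l)).
  by rewrite ler_powR// oppr_le0 invr_ge0 ltW.
(* Hoelder's inequality between fourier phi a * rho a ^ (- s/p) and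
   rho a ^ (s/p) * err a. *)
have step n : (vol l)^-1 * \sum_f Normc.normc (fourier l phi (frequency l f)) *
    err (@frequency R D l n f) <= vol l `^ (- p^-1) * (fine H *
    (\sum_f rho (frequency l f) `^ s * err (@frequency R D l n f) `^ p) `^ p^-1).
  have w0 f : 0 <= rho (@frequency R D l n f) `^ (s / p) * err (frequency l f).
    by rewrite mulr_ge0 ?powR_ge0 ?normc_ge0.
  have wE f : (rho (@frequency R D l n f) `^ (s / p) * err (frequency l f)) `^ p =
      rho (frequency l f) `^ s * err (frequency l f) `^ p.
    by rewrite powRM ?powR_ge0 ?normc_ge0// -powRrM divfK ?gt_eqF.
  have := lq_norm_hoelder V0 hp (frequency_inj hl (n := n))
    (fun f => dual_comb_in hl _) w0 Hoo.
  rewrite (eq_bigr _ (fun f _ => wE f)).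
  apply: le_trans; rewrite ler_wpM2l ?invr_ge0 ?(ltW V0)//.
  apply: ler_sum => f _; rewrite ger0_norm; last exact: u_ge0.
  have r0 : 0 < rho (@frequency R D l n f) `^ (s / p).
    by apply/powR_gt0/rho0/dual_comb_in.
  by rewrite powRN mulrA divfK ?gt_eqF.
have stepB B : (forall n, vol l `^ (- p^-1) * (fine H *
    (\sum_f rho (frequency l f) `^ s * err (@frequency R D l n f) `^ p) `^ p^-1)
    <= B) -> Normc.normc (quad_error l y phi) <= B.
  move=> bound; rewrite -[B](mulKf (lt0r_neq0 V0)).
  apply: (quad_error_le hl (continuous_parts cphi) pphi hN) => n.
  by rewrite -ler_pdivrMl// (le_trans (step n)).
(* The convention 0 * +oo = 0 makes a vanishing norm a separate case. *)
have hE : H = (fine H)%:E by rewrite fineK// ge0_fin_numE.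
have [hz|hn] := eqVneq (fine H) 0.
  rewrite hE hz mule0 mule0 lee_fin; apply: stepB => n.
  by rewrite hz mul0r mulr0.
have hgt : 0 < fine H by rewrite lt_neqAle eq_sym hn fine_ge0.
have [Ey|Efin] := eqVneq E +oo%E.
  by rewrite Ey hE gt0_mulye ?lte_fin// gt0_muley ?lte_fin ?powR_gt0// leey.
have {}Efin : E = (fine E)%:E by rewrite fineK// ge0_fin_numE// ltey.
rewrite hE Efin -!EFinM lee_fin; apply: stepB => n.
rewrite ler_wpM2l ?powR_ge0// mulrC ler_wpM2r ?(ltW hgt)//.
rewrite -lee_fin -Efin -poweR_EFin; apply: gt0_ler_poweR.
- by rewrite invr_ge0 ltW.
- rewrite in_itv/= leey andbT lee_fin sumr_ge0// => f _.
  by rewrite mulr_ge0 ?powR_ge0.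
- rewrite in_itv/= leey andbT esum_ge0// => a _.
  by rewrite lee_fin mulr_ge0 ?powR_ge0.
- apply: (finite_sum_le_esum (fun a => rho a `^ s * err a `^ p)).
    exact: frequency_inj.
  by move=> f; exact: dual_comb_in.
Qed.
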